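(* Let $\bm{G}^{(0)},\bm{G}^{(1)},\bm{P}(\varepsilon),\bm{C},\bm{V},\bm{W},\bm{\Gamma},\bar\pi$ be as defined in the context. Assume the following four conditions. (1) The unperturbed Markov chain $\bm{P}^{(0)}=\bm{I}+\bm{G}^{(0)}$ consists of several (denumerable) ergodic classes and has no transient states. (2) The Markov chains corresponding to the ergodic classes of the unperturbed chain (all having transition matrix $\bm{I}+\bm{C}$) are uniformly Lyapunov stable: there exist a strongly aperiodic state $\alpha\in\{1,2\}$ (i.e. the corresponding diagonal element of $\bm{I}+\bm{C}$ is strictly positive), constants $0<\delta<1$ and $b<\infty$, and a vector $\bm{u}=(u_1,u_2)'$ with $u_1,u_2\ge 1$, such that $(\bm{I}+\bm{C})\bm{u}\le \delta\bm{u}+b\,\bm{e}_\alpha$. (3) The aggregated Markov chain (with generator $\bm{\Gamma}$) is irreducible and Lyapunov stable: there exist a strongly aperiodic state $\bar\alpha\in\mathbb{N}^2$ (i.e. the corresponding diagonal element of $\bm{I}+\bm{\Gamma}$ is strictly positive), constants $0<\bar\delta<1$, $\bar b<\infty$, and $\overline{\bm{u}}=(\overline u_{(n_1,n_2)})_{(n_1,n_2)\in\mathbb{N}^2}$ with all $\overline u_{(n_1,n_2)}\ge 1$, such that $(\bm{I}+\bm{\Gamma})\overline{\bm{u}}\le\bar\delta\,\overline{\bm{u}}+\bar b\,\bm{e}_{\bar\alpha}$. (4) The perturbation matrix $\bm{G}^{(1)}$ is $\tilde{\bm{u}}$-bounded for $\tilde u_{(n_1,n_2,k)}=\overline u_{(n_1,n_2)}u_k$,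 i.e. $$\|\bm{G}^{(1)}\|_{\tilde{\bm{u}}}:=\sup_{\bm{s}\in\mathcal{S}}\tilde u_{\bm{s}}^{-1}\sum_{\overline{\bm{s}}\in\mathcal{S}}\left|\bm{G}^{(1)}_{\bm{s},\overline{\bm{s}}}\right|\tilde u_{\overline{\bm{s}}}$$ is bounded by some constant $g>0$. Then, for all sufficiently small $\varepsilon>0$, the perturbed Markov chain $\bm{P}(\varepsilon)$ has a unique invariant probability measure $\pi(\varepsilon)$, which is an analytic function of $\varepsilon$ near $0$, given by $$\pi(\varepsilon)=\sum_{m=0}^{\infty}\varepsilon^m\pi^{(m)},\qquad \pi^{(m)}=\bar\pi\,\bm{V}\,\bm{U}^m,$$ where $$\bm{U}=\bm{G}^{(1)}\bm{H}\left(\bm{I}+\bm{G}^{(1)}\bm{W}\bm{\Phi}\bm{V}\right),$$ and $\bm{H}$ and $\bm{\Phi}$, the deviation matrices of the unperturbed and aggregated Markov chains respectively, are given by $$\bm{H}=-\frac{1}{(c_1+c_2)^2}\,\bm{G}^{(0)},\qquad \bm{\Phi}=\sum_{m=0}^{\infty}\left[(\bm{I}+\bm{\Gamma})^m-\bm{\gamma}\right],$$ with $\bm{\gamma}=\lim_{n\to\infty}\frac1n\sum_{m=1}^n(\bm{I}+\bm{\Gamma})^m$ the ergodic projection of the aggregated Markov chain.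
   Context: Model. Two queues with independent Poisson arrivals of rates $\lambda_1,\lambda_2>0$ and exponential service times of rates $\mu_1,\mu_2>0$; a single server alternates between the queues, residing at queue $i$ for an exponentially distributed time with rate $c_i>0$ (independently of queue contents) and then switching instantaneously to the other queue; it serves only the queue where it resides. Arrival and service rates are scaled by $\varepsilon\ge0$ (becoming $\varepsilon\lambda_i$, $\varepsilon\mu_i$); the rates $c_i$ are not scaled. Stability is assumed: with $\rho_i=\lambda_i/\mu_i$, $\rho_1<\frac{c_2}{c_1+c_2}$ and $\rho_2<\frac{c_1}{c_1+c_2}$. Time is scaled so that $\lambda_1+\lambda_2+\mu_1+c_1\le1$ and $\lambda_1+\lambda_2+\mu_2+c_2\le1$. State space $\mathcal{S}=\{(n_1,n_2,k): n_1,n_2\in\mathbb{N},\,k\in\{1,2\}\}$ with $\mathbb{N}=\{0,1,2,\dots\}$; $n_i$ is the queue length of queue $i$ and $k$ is the queue where the server resides. The perturbed generator is $\bm{G}(\varepsilon)=\bm{G}^{(0)}+\varepsilon\bm{G}^{(1)}$ and the perturbed discrete-time (uniformized) Markov chain has transition matrix $\bm{P}(\varepsilon)=\bm{I}+\bm{G}(\varepsilon)$, $\varepsilon\in[0,1]$; the unperturbed chain has transition matrix $\bm{P}^{(0)}=\bm{I}+\bm{G}^{(0)}$. $\bm{G}^{(0)}$ is block diagonal with one $2\times2$ block $\bm{C}=\begin{bmatrix}-c_1&c_1\\c_2&-c_2\end{bmatrix}$ for every $(n_1,n_2)\in\mathbb{N}^2$ (acting on $k=1,2$). $\bm{G}^{(1)}$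 has entries, for $n_1,n_2\ge0$, $k=1,2$: $\bm{G}^{(1)}_{(n_1,n_2,k),(n_1+1,n_2,k)}=\lambda_1$, $\bm{G}^{(1)}_{(n_1,n_2,k),(n_1,n_2+1,k)}=\lambda_2$, $\bm{G}^{(1)}_{(n_1+1,n_2,1),(n_1,n_2,1)}=\mu_1$, $\bm{G}^{(1)}_{(n_1,n_2+1,2),(n_1,n_2,2)}=\mu_2$, $\bm{G}^{(1)}_{(n_1,n_2,k),(n_1,n_2,k)}=-(\lambda_1+\lambda_2+\mu_k\mathbf{1}_{\{n_k\ge1\}})$, and all other entries zero. The ergodic classes of the unperturbed chain are $\{(n_1,n_2,1),(n_1,n_2,2)\}$, indexed by $(n_1,n_2)\in\mathbb{N}^2$. $\bm{V}$ is the $\mathbb{N}^2\times\mathcal{S}$ matrix whose row $(n_1,n_2)$ has entries $\frac{c_2}{c_1+c_2}$ in column $(n_1,n_2,1)$, $\frac{c_1}{c_1+c_2}$ in column $(n_1,n_2,2)$ and zero elsewhere. $\bm{W}$ is the $\mathcal{S}\times\mathbb{N}^2$ matrix whose column $(n_1,n_2)$ has ones in rows $(n_1,n_2,1)$, $(n_1,n_2,2)$ and zeros elsewhere. The aggregated Markov chain on $\mathbb{N}^2$ has generator $\bm{\Gamma}=\bm{V}\bm{G}^{(1)}\bm{W}$. Its invariant probability measure is $\bar\pi(n_1,n_2)=(1-\tilde\rho_1)\tilde\rho_1^{n_1}(1-\tilde\rho_2)\tilde\rho_2^{n_2}$, $n_1,n_2\ge0$, with $\tilde\rho_i=\frac{\lambda_ic_i(c_1+c_2)}{\mu_ic_1c_2}$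 (a row vector). $\bm{I}$ is the identity matrix of the appropriate dimension; $\bm{e}_\alpha$ is the column vector with 1 in the entry of state $\alpha$ and zeros elsewhere; vector inequalities are componentwise. *)

(* Defs.v *)
From mathcomp Require Import all_boot all_order all_algebra.
From mathcomp Require Import all_classical all_reals all_analysis.

Set Implicit Arguments.
Unset Strict Implicit.
Unset Printing Implicit Defensive.

Import Order.TTheory GRing.Theory Num.Theory.
Import numFieldNormedType.Exports.

Local Open Scope classical_set_scope.
Local Open Scope ring_scope.


(* Unconditional sum of a real family. It is meaningful for summable families
   only: a divergent positive or negative part contributes the default 0 of
   [fine]. *)
Definition csum (R : realType) (I : choiceType) (f : I -> R) : R :=
  fine (\esum_(i in [set: I]) (EFin \o f)^\+%E i)
  - fine (\esum_(i in [set: I]) (EFin \o f)^\-%E i).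

Definition imx (R : realType) (I J : choiceType) := I -> J -> R.

Definition imx_id (R : realType) (I : choiceType) : imx R I I :=
  fun i j => (i == j)%:R.

Definition imx_add (R : realType) (I J : choiceType) (A B : imx R I J) :
  imx R I J := fun i j => A i j + B i j.

Definition imx_scale (R : realType) (I J : choiceType) (a : R) (A : imx R I J) :
  imx R I J := fun i j => a * A i j.

Definition imx_mul (R : realType) (I J K : choiceType)
    (A : imx R I J) (B : imx R J K) : imx R I K :=
  fun i k => csum (fun j => A i j * B j k).

Definition imx_pow (R : realType) (I : choiceType) (A : imx R I I) (n : nat) :
  imx R I I := iter n (imx_mul A) (@imx_id R I).

Definition rvec_mul (R : realType) (I J : choiceType)
    (v : I -> R) (A : imx R I J) : J -> R :=
  fun j => csum (fun i => v i * A i j).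

Definition mul_col (R : realType) (I J : choiceType)
    (A : imx R I J) (u : J -> R) : I -> R :=
  fun i => csum (fun j => A i j * u j).

Definition imx_mul_defined (R : realType) (I J K : choiceType)
    (A : imx R I J) (B : imx R J K) : Prop :=
  forall i k, summable [set: J] (fun j => (A i j * B j k)%:E).

Definition rvec_mul_defined (R : realType) (I J : choiceType)
    (v : I -> R) (A : imx R I J) : Prop :=
  forall j, summable [set: I] (fun i => (v i * A i j)%:E).

Definition unorm (R : realType) (I : choiceType) (u : I -> R) (A : imx R I I) :
    \bar R :=
  ereal_sup [set ((u i)^-1%:E * \esum_(j in [set: I]) (`|A i j| * u j)%:E)%E
            | i in [set: I]].


Definition invariant_prob (R : realType) (I : choiceType) (P : imx R I I)
    (p : I -> R) : Prop :=
  [/\ forall i, 0 <= p i,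
      \esum_(i in [set: I]) (p i)%:E = 1%E &
      forall j, rvec_mul p P j = p j].

Definition leads_to (R : realType) (I : choiceType) (P : imx R I I) (i j : I) :
  Prop := exists n, 0 < imx_pow P n i j.

Definition irreducible_chain (R : realType) (I : choiceType) (P : imx R I I) :
  Prop := forall i j, leads_to P i j.

Definition strongly_aperiodic (R : realType) (I : choiceType) (P : imx R I I)
    (i : I) : Prop := 0 < P i i.

(* [first_passage P n i j] is the probability, starting from [i], that the first
   visit to [j] at a time >= 1 takes place at time [n.+1]. *)
Fixpoint first_passage (R : realType) (I : choiceType) (P : imx R I I) (n : nat)
    (i j : I) : R :=
  if n is n'.+1 then
    csum (fun k => if k == j then 0 else P i k * first_passage P n' k j)
  else P i j.

Definition transient (R : realType) (I : choiceType) (P : imx R I I) (i : I) :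
  Prop := (\sum_(0 <= n <oo) (first_passage P n i i)%:E < 1)%E.

Definition positive_recurrent (R : realType) (I : choiceType) (P : imx R I I)
    (i : I) : Prop :=
  (\sum_(0 <= n <oo) (first_passage P n i i)%:E = 1)%E /\
  (\sum_(0 <= n <oo) (n.+1%:R * first_passage P n i i)%:E < +oo)%E.

(* A closed communicating class of positive recurrent states. *)
Definition ergodic_class (R : realType) (I : choiceType) (P : imx R I I)
    (E : set I) : Prop :=
  [/\ E !=set0,
      forall i j, E i -> (E j <-> leads_to P i j) &
      forall i, E i -> positive_recurrent P i].

Definition denumerable_ergodic_classes (R : realType) (I : choiceType)
    (P : imx R I I) : Prop :=
  [/\ ([set E | ergodic_class P E] #= [set: nat])%card,
      \bigcup_(E in [set E | ergodic_class P E]) E = [set: I] &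
      forall i, ~ transient P i].

Definition is_ergodic_projection (R : realType) (I : choiceType)
    (P Q : imx R I I) : Prop :=
  forall i j,
    (fun n : nat => n%:R^-1 * \sum_(1 <= m < n.+1) imx_pow P m i j) @ \oo
      --> Q i j.

(* [D] is the deviation matrix of [P], whose ergodic projection is [Q]. *)
Definition is_deviation_matrix (R : realType) (I : choiceType)
    (P Q D : imx R I I) : Prop :=
  forall i j, series (fun m : nat => imx_pow P m i j - Q i j) @ \oo --> D i j.

(* On ]-r, r[, [f] is the sum of the power series with coefficients [a], the
   convergence being in the l^1 (total variation) norm. *)
Definition l1_power_series (R : realType) (I : choiceType)
    (a : nat -> I -> R) (f : R -> I -> R) (r : R) : Prop :=
  forall e : R, `|e| < r ->
    (fun M : nat =>
       \esum_(i in [set: I]) `|f e i - \sum_(0 <= m < M) e ^+ m * a m i|%:E)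
      @ \oo --> 0%E.


(* The queues 1 and 2 are the elements 0 and 1 of 'I_2. *)
Definition q1 : 'I_2 := ord0.
Definition q2 : 'I_2 := ord_max.

Notation queues := (nat * nat)%type (only parsing).
Notation state := (nat * nat * 'I_2)%type (only parsing).

Definition len (n : queues) (i : 'I_2) : nat := if i == q1 then n.1 else n.2.

Record rates (R : realType) := Rates {
  lam : 'I_2 -> R;
  mu : 'I_2 -> R;
  cc : 'I_2 -> R (* switching rates *)
}.

Definition positive_rates (R : realType) (q : rates R) : Prop :=
  forall i, [/\ 0 < lam q i, 0 < mu q i & 0 < cc q i].

Definition csm (R : realType) (q : rates R) : R := cc q q1 + cc q q2.

(* The server is at queue [i] for a fraction [share q i] of the time. *)
Definition share (R : realType) (q : rates R) (i : 'I_2) : R :=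
  cc q (rev_ord i) / csm q.

Definition stable (R : realType) (q : rates R) : Prop :=
  forall i, lam q i / mu q i < share q i.

Definition time_scaled (R : realType) (q : rates R) : Prop :=
  forall i, lam q q1 + lam q q2 + mu q i + cc q i <= 1.

Definition Cblock (R : realType) (q : rates R) : 'M[R]_2 :=
  \matrix_(i, j) (if i == j then - cc q i else cc q i).

Definition G0 (R : realType) (q : rates R) : imx R state state :=
  fun s t => if s.1 == t.1 then Cblock q s.2 t.2 else 0.

Definition G1 (R : realType) (q : rates R) : imx R state state :=
  fun s t =>
    let: (n1, n2, k) := s in let: (m1, m2, l) := t in
    if k != l then 0
    else if (m1 == n1.+1) && (m2 == n2) then lam q q1
    else if (m1 == n1) && (m2 == n2.+1) then lam q q2
    else if [&& k == q1, n1 == m1.+1 & n2 == m2] then mu q q1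
    else if [&& k == q2, n1 == m1 & n2 == m2.+1] then mu q q2
    else if (m1 == n1) && (m2 == n2) then
      - (lam q q1 + lam q q2 + mu q k * (1 <= len (n1, n2) k)%N%:R)
    else 0.

Definition Peps (R : realType) (q : rates R) (e : R) : imx R state state :=
  imx_add (@imx_id R state) (imx_add (G0 q) (imx_scale e (G1 q))).

Definition P0 (R : realType) (q : rates R) : imx R state state :=
  imx_add (@imx_id R state) (G0 q).

Definition Vmx (R : realType) (q : rates R) : imx R queues state :=
  fun n s => if s.1 == n then share q s.2 else 0.

Definition Wmx (R : realType) : imx R state queues := fun s n => (s.1 == n)%:R.

Definition Gam (R : realType) (q : rates R) : imx R queues queues :=
  imx_mul (imx_mul (Vmx q) (G1 q)) (@Wmx R).

Definition Pbar (R : realType) (q : rates R) : imx R queues queues :=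
  imx_add (@imx_id R queues) (Gam q).

Definition rhot (R : realType) (q : rates R) (i : 'I_2) : R :=
  (lam q i * cc q i * csm q) / (mu q i * cc q q1 * cc q q2).

Definition pibar (R : realType) (q : rates R) : queues -> R :=
  fun n => (1 - rhot q q1) * rhot q q1 ^+ n.1
           * ((1 - rhot q q2) * rhot q q2 ^+ n.2).

Definition Hmx (R : realType) (q : rates R) : imx R state state :=
  imx_scale (- (csm q ^+ 2)^-1) (G0 q).

Definition Umx (R : realType) (q : rates R) (Phi : imx R queues queues) :
    imx R state state :=
  imx_mul (imx_mul (G1 q) (Hmx q))
    (imx_add (@imx_id R state)
       (imx_mul (imx_mul (imx_mul (G1 q) (@Wmx R)) Phi) (Vmx q))).

Definition pi_coef (R : realType) (q : rates R) (Phi : imx R queues queues)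
    (m : nat) : state -> R :=
  rvec_mul (rvec_mul (pibar q) (Vmx q)) (imx_pow (Umx q Phi) m).

Definition class_lyapunov (R : realType) (q : rates R) (alpha : 'I_2)
    (delta b : R) (u : 'cV[R]_2) : Prop :=
  [/\ 0 < (1%:M + Cblock q) alpha alpha,
      0 < delta < 1,
      forall k, 1 <= u k 0 &
      forall k, ((1%:M + Cblock q) *m u) k 0
                <= (delta *: u + b *: delta_mx alpha 0) k 0].

Definition lyapunov (R : realType) (I : choiceType) (P : imx R I I) (alpha : I)
    (delta b : R) (u : I -> R) : Prop :=
  [/\ strongly_aperiodic P alpha,
      0 < delta < 1,
      forall i, 1 <= u i &
      forall i, mul_col P u i <= delta * u i + b * (i == alpha)%:R].

Definition utilde (R : realType) (ub : queues -> R) (u : 'cV[R]_2) :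
  state -> R := fun s => ub s.1 * u s.2 0.

(* Main.v *)
Require Import Defs.
From mathcomp Require Import all_boot all_order all_algebra.
From mathcomp Require Import all_classical all_reals all_analysis.
From mathcomp Require Import ring lra zify.
Import Order.TTheory GRing.Theory Num.Theory.
Import numFieldNormedType.Exports.
Local Open Scope classical_set_scope.
Local Open Scope ring_scope.

Set Implicit Arguments.
Unset Strict Implicit.
Unset Printing Implicit Defensive.

(** The measure [pi e] is constructed as a power series and then recognized.

    Write [p_m] for [pibar V U^m]. The matrix [U] is made so that [p_0 G0 =
    0] and [p_(m+1) G0 = - p_m G1]: multiplying [U] by [G0] on the right
    gives [G1 (W V - I)], and the term [p_m G1 W V] vanishes because [pibar
    Gam = 0] for [m = 0] and because [U G1 W = 0] in general. The latter
    holds since [I + Phi Gam] is the ergodic projection [gam] of the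
    aggregated chain, whose rows are all equal, whereas the rows of [G1] sum
    to zero. So, as soon as the series [\sum_m e^m p_m] converges in a norm
    for which all the matrices are bounded, its sum is invariant under [I +
    G0 + e G1], and its total mass is that of [p_0], namely [1]. For [0 < e
    <= 1] the perturbed chain is stochastic and irreducible; a summable
    invariant vector of such a chain has a constant sign, for its positive
    part is invariant as well ([invariant_nonpos]). This gives at once the
    positivity of the sum and its uniqueness ([invariant_prob_unique]).

    The norm is the weighted [l^1] norm for the weight [wq n = r1 ^+ n.1 *
    r2 ^+ n.2] with [1 < r_i] and [lam_i * r_i] less than the mean service
    rate of queue [i], which stability allows. The matrices [G0], [G1], [V],
    [W] and [Gam] have at most five nonzero entries per row and are bounded
    by inspection. For [Phi] one needs that the powers of the aggregated
    transition matrix converge geometrically to [gam] in operator norm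
    ([aggregated_ergodic]). The aggregated chain is an explicit random walk
    in the quarter plane: it acts on the increments of a function along the
    edges of the grid with nonnegative coefficients, and contracts the
    supremum of these increments divided by suitable edge lengths
    ([edge_contraction], [lip_step]). A function of order [wq] has bounded
    increments in this sense, and conversely increments bound the distance
    of the values of a function to its mean, by invariance of the geometric
    measure [pibar], which follows from detailed balance.

    The deviation matrix [H] of the unperturbed chain is a geometric series,
    because [G0] is a multiple of a projection ([P0_deviation]). *)

(** * Unconditional sums of real families *)

Section Sums.
Variable R : realType.
Implicit Types I J : choiceType.

(** Absolute summability of a real family. *)
Definition asummable I (f : I -> R) : Prop :=
  summable [set: I] (fun i => (f i)%:E).

Lemma asummable_le I (f g : I -> R) :
  (forall i, `|f i| <= g i) -> asummable g -> asummable f.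
Proof.
move=> fg; apply: le_lt_trans; apply: le_esum => i _ /=.
by rewrite lee_fin (le_trans (fg i))// ler_norm.
Qed.

Lemma asummable_esum I (f : I -> R) (N : R) :
  (\esum_(i in [set: I]) `|f i|%:E <= N%:E)%E -> asummable f.
Proof. by move=> fN; apply: (le_lt_trans fN); rewrite ltry. Qed.

Lemma asummableD I (f g : I -> R) :
  asummable f -> asummable g -> asummable (f \+ g).
Proof. by move=> sf sg; exact: (summableD sf sg). Qed.

Lemma esumZ I (k : R) (a : I -> R) : 0 <= k -> (forall i, 0 <= a i) ->
  (\esum_(i in [set: I]) (k * a i)%:E = k%:E * \esum_(i in [set: I]) (a i)%:E)%E.
Proof.
move=> k0 a0; have [->|k1] := eqVneq k 0.
  by rewrite mul0e esum1// => i _; rewrite mul0r.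
have kp : 0 < k by rewrite lt_neqAle eq_sym k1.
have le1 (k' : R) (a' : I -> R) : 0 < k' -> (forall i, 0 <= a' i) ->
   (\esum_(i in [set: I]) (k' * a' i)%:E <=
    k'%:E * \esum_(i in [set: I]) (a' i)%:E)%E.
  move=> k'0 a'0; apply: ge_ereal_sup => _ /= [X [finX _] <-].
  rewrite (_ : (\sum_(x \in X) _ = k'%:E * \sum_(x \in X) (a' x)%:E)%E).
    apply: lee_wpmul2l; first by rewrite lee_fin ltW.
    by apply: ereal_sup_ubound; exists X.
  by rewrite ge0_mule_fsumr// => i; rewrite lee_fin.
apply/eqP; rewrite eq_le le1//=.
have := le1 k^-1 (fun i => k * a i).
rewrite invr_gt0 => /(_ kp) h.
have {}h := h (fun i => mulr_ge0 k0 (a0 i)).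
rewrite (_ : \esum_(i in [set: I]) (a i)%:E =
   \esum_(i in [set: I]) (k^-1 * (k * a i))%:E)%E; last first.
  by apply: eq_esum => i _; rewrite mulKf.
apply: le_trans (lee_wpmul2l _ h) _; first by rewrite lee_fin.
by rewrite muleA -EFinM divff// mul1e.
Qed.

Lemma asummableZ I (k : R) (f : I -> R) :
  asummable f -> asummable (fun i => k * f i).
Proof.
move=> sf; rewrite /asummable /summable.
rewrite (_ : \esum_(i in [set: I]) _ =
  \esum_(i in [set: I]) (`|k| * `|f i|)%:E)%E; last first.
  by apply: eq_esum => i _ /=; rewrite normrM.
rewrite esumZ//.
have : \esum_(i in [set: I]) `|f i|%:E \is a fin_num.
  by move: sf; rewrite /asummable summableE.
by move=> /fineK <-; rewrite -EFinM ltry.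
Qed.

Lemma asummable_abs I (f : I -> R) : asummable f -> asummable (fun i => `|f i|).
Proof.
by apply: le_lt_trans; apply: le_esum => i _ /=; rewrite lee_fin normr_id.
Qed.

Lemma asummable_max0 I (f : I -> R) :
  asummable f -> asummable (fun i => Num.max (f i) 0).
Proof.
move=> sf; apply: (asummable_le _ (asummable_abs sf)) => i.
rewrite ger0_norm; last by rewrite le_max lexx orbT.
by rewrite ge_max normr_ge0 ler_norm.
Qed.

Lemma csum_ge0E I (f : I -> R) : (forall i, 0 <= f i) -> asummable f ->
  (csum f)%:E = \esum_(i in [set: I]) (f i)%:E.
Proof.
move=> f0 sf; rewrite /csum.
rewrite (_ : \esum_(i in _) (EFin \o f)^\- i = 0)%E; last first.
  apply: esum1 => i _; rewrite funenegE /=.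
  by apply/max_idPr; rewrite lee_fin oppr_le0.
rewrite (_ : \esum_(i in _) (EFin \o f)^\+ i = \esum_(i in [set: I]) (f i)%:E)%E.
  rewrite subr0 fineK//; move: sf; rewrite /asummable summableE.
  by under eq_esum => i _ do rewrite /= ger0_norm//.
apply: eq_esum => i _; rewrite funeposE /=.
by apply/max_idPl; rewrite lee_fin.
Qed.

Lemma csum_ge0 I (f : I -> R) :
  (forall i, 0 <= f i) -> asummable f -> 0 <= csum f.
Proof.
move=> f0 sf; rewrite -lee_fin csum_ge0E//.
by apply: esum_ge0 => i _; rewrite lee_fin.
Qed.

Lemma csumB_ge0 I (f g : I -> R) : (forall i, 0 <= f i) -> (forall i, 0 <= g i) ->
  asummable f -> asummable g -> csum (fun i => f i - g i) = csum f - csum g.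
Proof.
move=> f0 g0 sf sg; have := @esumB _ _ [set: I] _ _ sf sg.
rewrite -csum_ge0E// -csum_ge0E// => H.
apply: EFin_inj; rewrite [RHS]EFinB -H; last 2 first.
- by move=> i _; rewrite lee_fin.
- by move=> i _; rewrite lee_fin.
have sfg : asummable (fun i => f i - g i) := summableB sf sg.
have fin1 := summable_funepos sfg; have fin2 := summable_funeneg sfg.
rewrite /csum EFinB !fineK//.
- move: fin2; rewrite summableE.
  by under eq_esum => i _ do rewrite gee0_abs//.
- move: fin1; rewrite summableE.
  by under eq_esum => i _ do rewrite gee0_abs//.
Qed.

Lemma maxr_posneg (x : R) : Num.max x 0 - Num.max (- x) 0 = x.
Proof.
have [x0|/ltW x0] := lerP 0 x.
  by rewrite max_r ?subr0// oppr_le0.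
by rewrite max_l ?sub0r ?opprK// oppr_ge0.
Qed.

Lemma eq_csum I (f g : I -> R) : f =1 g -> csum f = csum g.
Proof. by move=> /funext ->. Qed.

Lemma csum_posneg I (f : I -> R) : asummable f ->
  csum f = csum (fun i => Num.max (f i) 0) - csum (fun i => Num.max (- f i) 0).
Proof.
move=> sf.
have sn : asummable (fun i => - f i).
  by apply: (asummable_le _ (asummable_abs sf)) => i; rewrite normrN.
rewrite -csumB_ge0; first last.
- exact: asummable_max0.
- exact: asummable_max0.
- by move=> i; rewrite le_max lexx orbT.
- by move=> i; rewrite le_max lexx orbT.
by apply: eq_csum => i; rewrite maxr_posneg.
Qed.

Lemma csumD_ge0 I (f g : I -> R) : (forall i, 0 <= f i) -> (forall i, 0 <= g i) ->
  asummable f -> asummable g -> csum (fun i => f i + g i) = csum f + csum g.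
Proof.
move=> f0 g0 sf sg; apply: EFin_inj; rewrite [RHS]EFinD !csum_ge0E//.
- by rewrite -esumD => // i _; rewrite lee_fin.
- by move=> i; rewrite addr_ge0.
- exact: asummableD.
Qed.

Lemma csumN I (f : I -> R) :
  asummable f -> csum (fun i => - f i) = - csum f.
Proof.
move=> sf.
have sn : asummable (fun i => - f i).
  by apply: (asummable_le _ (asummable_abs sf)) => i; rewrite normrN.
rewrite (csum_posneg sn) (csum_posneg sf) [RHS]opprB; congr (_ - _).
by apply: eq_csum => i; rewrite opprK.
Qed.

Lemma csumD I (f g : I -> R) : asummable f -> asummable g ->
  csum (fun i => f i + g i) = csum f + csum g.
Proof.
move=> sf sg.
have max_ge0 (x : R) : 0 <= Num.max x 0 by rewrite le_max lexx orbT.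
have sN (h : I -> R) : asummable h -> asummable (fun j => - h j).
  by move=> sh; apply: (asummable_le _ (asummable_abs sh)) => i; rewrite normrN.
rewrite [csum f]csum_posneg// [csum g]csum_posneg// addrACA -opprD.
have sf1 := asummable_max0 sf; have sg1 := asummable_max0 sg.
have sf2 := asummable_max0 (sN _ sf); have sg2 := asummable_max0 (sN _ sg).
rewrite -!csumD_ge0// -csumB_ge0//; first last.
- exact: asummableD.
- exact: asummableD.
- by move=> i; rewrite addr_ge0.
- by move=> i; rewrite addr_ge0.
by apply: eq_csum => i; rewrite opprD addrACA !maxr_posneg.
Qed.

Lemma csumB I (f g : I -> R) : asummable f -> asummable g ->
  csum (fun i => f i - g i) = csum f - csum g.
Proof.
move=> sf sg; rewrite csumD ?csumN//.
by apply: (asummable_le _ (asummable_abs sg)) => i; rewrite normrN.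
Qed.

Lemma csumZ I (k : R) (f : I -> R) : asummable f ->
  csum (fun i => k * f i) = k * csum f.
Proof.
have pos (c : R) (h : I -> R) : 0 <= c -> (forall i, 0 <= h i) -> asummable h ->
    csum (fun i => c * h i) = c * csum h.
  move=> c0 h0 sh; apply: EFin_inj; rewrite [RHS]EFinM !csum_ge0E//.
  - exact: esumZ.
  - by move=> i; rewrite mulr_ge0.
  - exact: asummableZ.
have max_ge0 (x : R) : 0 <= Num.max x 0 by rewrite le_max lexx orbT.
have gen (c : R) (h : I -> R) : 0 <= c -> asummable h ->
    csum (fun i => c * h i) = c * csum h.
  move=> c0 sh; rewrite csum_posneg ?[csum h]csum_posneg//; last exact: asummableZ.
  have sN : asummable (fun j => - h j).
    by apply: (asummable_le _ (asummable_abs sh)) => i; rewrite normrN.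
  rewrite mulrBr -!pos//; do ?exact: asummable_max0.
  by congr (_ - _); apply: eq_csum => i; rewrite maxr_pMr// mulr0 ?mulrN.
move=> sf; have [k0|/ltW k0] := lerP 0 k; first exact: gen.
rewrite -[k]opprK mulNr -gen ?oppr_ge0// -csumN; last exact: asummableZ.
by apply: eq_csum => i; rewrite !mulNr.
Qed.

Lemma le_csum I (f g : I -> R) : (forall i, f i <= g i) ->
  asummable f -> asummable g -> csum f <= csum g.
Proof.
move=> fg sf sg; rewrite -subr_ge0 -csumB//; apply: csum_ge0 => [i|].
  by rewrite subr_ge0.
exact: (summableB sg sf).
Qed.

Lemma normr_csum I (f : I -> R) (g : I -> R) : (forall i, `|f i| <= g i) ->
  asummable g -> `|csum f| <= csum g.
Proof.
move=> fg sg; have sf := asummable_le fg sg.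
rewrite ler_norml; apply/andP; split; last first.
  by apply: le_csum => // i; rewrite (le_trans (ler_norm _)).
rewrite -csumN//; apply: le_csum => //.
  by move=> i; rewrite lerNl (le_trans (ler_norm _))// normrN.
by apply: (asummable_le _ (asummable_abs sg)) => i; rewrite normrN.
Qed.

Lemma csum_ge0_eq0 I (f : I -> R) : (forall i, 0 <= f i) -> asummable f ->
  csum f = 0 -> forall i, f i = 0.
Proof.
move=> f0 sf s0 i; apply/eqP; rewrite eq_le f0 andbT -lee_fin -[leRHS]/(0%:E).
rewrite -s0 csum_ge0E// (esumID [set i])//.
  rewrite setTI esum_set1// ?lee_fin//.
  by rewrite leeDl// esum_ge0// => j _; rewrite lee_fin.
by move=> j _; rewrite lee_fin.
Qed.

Lemma csum1 I (i : I) (f : I -> R) : (forall j, j != i -> f j = 0) ->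
  asummable f /\ csum f = f i.
Proof.
move=> f0.
have E (g : I -> R) : (forall j, j != i -> g j = 0) -> (forall j, 0 <= g j) ->
    \esum_(j in [set: I]) (g j)%:E = (g i)%:E.
  move=> g0 gp; rewrite (esumID [set i]); last by move=> j _; rewrite lee_fin.
  rewrite setTI esum_set1 ?lee_fin// esum1 ?adde0// => j [_ /eqP ji].
  by rewrite g0.
have sf : asummable f.
  apply: (@asummable_esum _ _ `|f i|); rewrite E// => j ji.
  by rewrite f0// normr0.
split => //; rewrite csum_posneg//.
have sN : asummable (fun j => - f j).
  by apply: (asummable_le _ (asummable_abs sf)) => j; rewrite normrN.
have H (h : I -> R) : asummable h -> (forall j, j != i -> h j = 0) ->
    csum (fun j : I => Num.max (h j) 0) = Num.max (h i) 0.
  move=> sh h0; apply: EFin_inj; rewrite csum_ge0E; first last.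
  - exact: asummable_max0.
  - by move=> j; rewrite le_max lexx orbT.
  rewrite E// => j; first by move=> /h0 ->; rewrite maxxx.
  by rewrite le_max lexx orbT.
rewrite !H//; last by move=> j /f0 ->; rewrite oppr0.
by rewrite maxr_posneg.
Qed.

Lemma csum_cst0 I : asummable (fun _ : I => 0 : R) /\ csum (fun _ : I => 0 : R) = 0.
Proof.
have s0 : asummable (fun _ : I => 0 : R).
  rewrite /asummable /summable esum1 ?ltry// => i _.
  by rewrite abse0.
split => //; apply: EFin_inj; rewrite csum_ge0E// esum1//.
Qed.

Lemma csum_sum I (T : Type) (s : seq T) (F : T -> I -> R) :
  (forall t, asummable (F t)) ->
  asummable (fun i => \sum_(t <- s) F t i) /\
  csum (fun i => \sum_(t <- s) F t i) = \sum_(t <- s) csum (F t).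
Proof.
move=> sF; elim: s => [|t s [IH1 IH2]].
  rewrite big_nil (_ : (fun i => _) = fun=> 0); first exact: csum_cst0.
  by apply/funext => i; rewrite big_nil.
rewrite big_cons (_ : (fun i => _) = fun i => F t i + \sum_(t <- s) F t i).
  by rewrite csumD// IH2; split=> //; exact: (asummableD (sF t) IH1).
by apply/funext => i; rewrite big_cons.
Qed.

Lemma esum_exchange I J (a : I -> J -> \bar R) : (forall i j, 0 <= a i j)%E ->
  \esum_(i in [set: I]) \esum_(j in [set: J]) a i j =
  \esum_(j in [set: J]) \esum_(i in [set: I]) a i j.
Proof.
move=> a0; rewrite !esum_esum//.
rewrite (reindex_esum ([set: J] `*`` (fun=> [set: I])) _ (fun x => (x.2, x.1)))//.
split=> //=.
  by move=> [i1 i2] [j1 j2] /= _ _ [] -> ->.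
by move=> [i1 i2] _ /=; exists (i2, i1).
Qed.

(** Fubini's theorem for absolutely summable double families. *)
Lemma csum_exchange I J (f : I -> J -> R) (N : R) :
  (\esum_(i in [set: I]) \esum_(j in [set: J]) `|f i j|%:E <= N%:E)%E ->
  csum (fun i => csum (fun j => f i j)) = csum (fun j => csum (fun i => f i j)).
Proof.
have rowsum (K L : choiceType) (h : K -> L -> R) :
   (\esum_(i in [set: K]) \esum_(j in [set: L]) `|h i j|%:E <= N%:E)%E ->
   (forall i, asummable (h i)) /\
   forall k : K -> L -> R, (forall i j, `|k i j| <= `|h i j|) ->
     asummable (fun i => csum (k i)).
  move=> hN; have sh i : asummable (h i).
    apply: (@asummable_esum _ _ N); apply: le_trans hN.
    rewrite (esumID [set i] [set: K]).
      rewrite setTI esum_set1 ?leeDl//; last first.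
        by apply: esum_ge0 => j _; rewrite lee_fin.
      by apply: esum_ge0 => j _; apply: esum_ge0 => j' _; rewrite lee_fin.
    by move=> k _; apply: esum_ge0 => j _; rewrite lee_fin.
  split=> // k kh; apply: (@asummable_esum _ _ N); apply: le_trans hN.
  apply: le_esum => i _; rewrite -csum_ge0E//; last exact: asummable_abs.
  by rewrite lee_fin; apply: normr_csum => //; exact: asummable_abs.
move=> fN; have [sf1 sf2] := rowsum _ _ _ fN.
have fN' : (\esum_(j in [set: J]) \esum_(i in [set: I]) `|f i j|%:E <= N%:E)%E.
  by rewrite esum_exchange// => i j; rewrite lee_fin.
have [sg1 sg2] := rowsum _ _ (fun j i => f i j) fN'.
have sN (K : choiceType) (h : K -> R) : asummable h -> asummable (fun i => - h i).
  by move=> sh; apply: (asummable_le _ (asummable_abs sh)) => j; rewrite normrN.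
have pos (h : I -> J -> R) : (forall i j, 0 <= h i j <= `|f i j|) ->
    csum (fun i => csum (h i)) = csum (fun j => csum (fun i => h i j)).
  move=> hf; have h0 i j : 0 <= h i j by have /andP[] := hf i j.
  have {}hf i j : `|h i j| <= `|f i j|.
    by have /andP[_] := hf i j; rewrite (ger0_norm (h0 i j)).
  have s1 i : asummable (h i) by apply: (asummable_le (hf i)); exact: asummable_abs.
  have s2 j : asummable (fun i => h i j).
    apply: (asummable_le (fun i => hf i j)).
    exact: (@asummable_abs _ (fun i => f i j)).
  apply: EFin_inj; rewrite csum_ge0E; last 2 first.
  - by move=> i; apply: csum_ge0.
  - exact: sf2.
  rewrite csum_ge0E; last 2 first.
  - by move=> i; apply: csum_ge0.
  - by apply: (sg2 (fun j i => h i j)) => i j.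
  rewrite (@eq_esum _ _ _ _ (fun i => \esum_(j in [set: J]) (h i j)%:E)); last first.
    by move=> i _; rewrite csum_ge0E.
  rewrite esum_exchange; last by move=> i j; rewrite lee_fin.
  by apply: eq_esum => i _; rewrite csum_ge0E.
have b1 i j : 0 <= Num.max (f i j) 0 <= `|f i j|.
  by rewrite le_max lexx orbT/= ge_max ler_norm normr_ge0.
have b2 i j : 0 <= Num.max (- f i j) 0 <= `|f i j|.
  by rewrite le_max lexx orbT/= ge_max normr_ge0 -normrN ler_norm.
have b3 (a b : R) : 0 <= a <= b -> `|a| <= b.
  by move=> /andP[a0 ab]; rewrite ger0_norm.
transitivity (csum (fun i => csum (fun j => Num.max (f i j) 0)) -
              csum (fun i => csum (fun j => Num.max (- f i j) 0))).
  rewrite -csumB//; first by apply: eq_csum => i; rewrite -csum_posneg.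
  - by apply: sf2 => i j; exact: b3.
  - by apply: sf2 => i j; exact: b3.
rewrite !pos// -csumB//.
- by apply: eq_csum => j; rewrite -(csum_posneg (sg1 j)).
- by apply: (sg2 (fun j i => Num.max (f i j) 0)) => i j; exact: b3.
- by apply: (sg2 (fun j i => Num.max (- f i j) 0)) => i j; exact: b3.
Qed.

End Sums.

(** * Weighted summable vectors and bounded matrices *)

Section Weighted.
Variable R : realType.
Implicit Types I J L : choiceType.

(** The weighted norm [\sum_i |v i| w i] of the row vector [v] is at most [N]. *)
Definition wle I (w v : I -> R) (N : R) : Prop :=
  (\esum_(i in [set: I]) (`|v i| * w i)%:E <= N%:E)%E.

(** The matrix [A], acting on row vectors, has operator norm at most [K] from
    the [w]-norm to the [w']-norm. This is tested on its rows: row [i] is the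
    image of the unit vector [e_i], whose [w]-norm is [w i]. *)
Definition opbound I J (w : I -> R) (w' : J -> R) (A : imx R I J) (K : R) :=
  0 <= K /\ forall i, wle w' (A i) (K * w i).

(** Boundedness of [A] as an operator between weighted spaces; a weight on each
    index type is part of the data. *)
Definition bounded_mx I J (w : I -> R) (w' : J -> R) (A : imx R I J) : Prop :=
  exists K, opbound w w' A K.

Lemma wle_finite I (w v : I -> R) N :
  (forall F : set I, finite_set F -> \sum_(i \in F) `|v i| * w i <= N) ->
  wle w v N.
Proof.
move=> H; apply: ge_ereal_sup => _ /= [F [finF _] <-].
by rewrite fsumEFin// lee_fin H.
Qed.

Lemma wle_fsum I (w v : I -> R) N (F : set I) : wle w v N -> finite_set F ->
  \sum_(i \in F) `|v i| * w i <= N.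
Proof.
move=> H finF; rewrite -lee_fin -fsumEFin//; apply: le_trans H.
by apply: ereal_sup_ubound; exists F.
Qed.

Lemma wle_ge0 I (w v : I -> R) N : wle w v N -> 0 <= N.
Proof. by move=> /wle_fsum /(_ (finite_set0 _)); rewrite fsbig_set0. Qed.

Lemma wle_le I (w v : I -> R) N N' : wle w v N -> N <= N' -> wle w v N'.
Proof. by move=> H NN; apply: (le_trans H); rewrite lee_fin. Qed.

Lemma wle_pt I (w v : I -> R) N i : wle w v N -> `|v i| * w i <= N.
Proof. by move=> /wle_fsum /(_ (finite_set1 i)); rewrite fsbig_set1. Qed.

Section OneWeight.
Variables (I : choiceType) (w : I -> R).
Hypothesis w0 : forall i, 0 < w i.

Let aw_ge0 (v : I -> R) i : 0 <= `|v i| * w i.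
Proof. by rewrite mulr_ge0// ltW. Qed.

Lemma wle_asummable (v : I -> R) N :
  wle w v N -> asummable (fun i => `|v i| * w i).
Proof.
move=> H; apply: (@asummable_esum _ _ _ N); apply: le_trans H.
by apply: le_esum => i _; rewrite ger0_norm.
Qed.

Lemma wle_mono (v v' : I -> R) N :
  (forall i, `|v i| <= `|v' i|) -> wle w v' N -> wle w v N.
Proof.
move=> vv; apply: le_trans; apply: le_esum => i _.
by rewrite lee_fin ler_wpM2r// ltW.
Qed.

Lemma wleD (v v' : I -> R) N N' :
  wle w v N -> wle w v' N' -> wle w (fun i => v i + v' i) (N + N').
Proof.
move=> H H'; rewrite /wle EFinD; apply: le_trans (leeD H H').
rewrite -esumD; last 2 first.
- by move=> i _; rewrite lee_fin.
- by move=> i _; rewrite lee_fin.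
by apply: le_esum => i _; rewrite lee_fin -mulrDl ler_wpM2r ?ler_normD ?ltW.
Qed.

Lemma wleZ (k : R) (v : I -> R) N :
  wle w v N -> wle w (fun i => k * v i) (`|k| * N).
Proof.
move=> H; rewrite /wle EFinM.
rewrite (_ : esum _ _ =
    \esum_(i in [set: I]) (`|k| * (`|v i| * w i))%:E)%E; last first.
  by apply: eq_esum => i _; rewrite normrM mulrA.
by rewrite esumZ// lee_wpmul2l// lee_fin.
Qed.

Lemma wle0 : wle w (fun=> 0) 0.
Proof. by rewrite /wle esum1// => i _; rewrite normr0 mul0r. Qed.

Lemma wle_sum (T : Type) (s : seq T) (F : T -> I -> R) (N : T -> R) :
  (forall t, wle w (F t) (N t)) ->
  wle w (fun i => \sum_(t <- s) F t i) (\sum_(t <- s) N t).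
Proof.
move=> H; elim: s => [|t s IH].
  rewrite big_nil (_ : (fun i => _) = fun=> 0); first exact: wle0.
  by apply/funext => i; rewrite big_nil.
rewrite big_cons (_ : (fun i => _) = fun i => F t i + \sum_(t <- s) F t i).
  exact: wleD.
by apply/funext => i; rewrite big_cons.
Qed.

(** Pairing of a vector of finite norm with a function of order [w]. *)
Lemma wle_pair (v f : I -> R) N C : 0 <= C -> wle w v N ->
  (forall i, `|f i| <= C * w i) ->
  asummable (fun i => v i * f i) /\ `|csum (fun i => v i * f i)| <= N * C.
Proof.
move=> C0 H fC.
have sv := wle_asummable H.
have vf i : `|v i * f i| <= C * (`|v i| * w i).
  by rewrite normrM mulrCA ler_wpM2l.
split; first by apply: (asummable_le vf); exact: asummableZ.
apply: (le_trans (normr_csum vf _)); first exact: asummableZ.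
rewrite csumZ// mulrC ler_wpM2r// -lee_fin csum_ge0E//.
Qed.

(** Fatou's lemma: norm bounds pass to entrywise limits. *)
Lemma wle_lim (v : nat -> I -> R) (S : I -> R) N :
  (forall i, v ^~ i @ \oo --> S i) -> (forall n, wle w (v n) N) -> wle w S N.
Proof.
move=> vS vN; apply: wle_finite => F finF.
rewrite fsbig_finite//=; set s := (X in \sum_(i <- X) _).
have cv : (fun n => \sum_(i <- s) `|v n i| * w i) @ \oo -->
    \sum_(i <- s) `|S i| * w i.
  apply: cvg_big; first exact: add_continuous.
  by move=> i _; apply: cvgMr_tmp; exact: cvg_norm (vS i).
rewrite -(cvg_lim _ cv)//; apply: limr_le; first by apply/cvg_ex; eexists; exact: cv.
by apply: nearW => n; rewrite -fsbig_finite//; exact: wle_fsum.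
Qed.

(** [S] is the sum of the series of the vectors [v m], with a geometric control
    of the norm of the remainders. *)
Definition wseries (v : nat -> I -> R) (S : I -> R) (C k : R) : Prop :=
  forall M, wle w (fun i => S i - \sum_(0 <= m < M) v m i) (C * k ^+ M).

Lemma geo_cvg0 (C k : R) : 0 <= k < 1 -> (fun n => C * k ^+ n) @ \oo --> (0 : R).
Proof. by move=> /andP[k0 k1]; apply: cvg_geometric; rewrite ger0_norm. Qed.

Lemma sum_geo_le (k : R) M n : 0 <= k < 1 ->
  \sum_(M <= m < n) k ^+ m <= (1 - k)^-1 * k ^+ M.
Proof.
move=> /andP[k0 k1]; have k1' : 0 < 1 - k by rewrite subr_gt0.
have [nM|Mn] := leqP n M.
  by rewrite big_geq// mulr_ge0 ?exprn_ge0// invr_ge0 ltW.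
rewrite ler_pdivlMl//.
have -> : (1 - k) * \sum_(M <= m < n) k ^+ m = k ^+ M - k ^+ n.
  rewrite mulr_sumr -[RHS]opprB -(@telescope_sumr _ M n (fun m => k ^+ m)) ?(ltnW Mn)//.
  by rewrite -sumrN; apply: eq_bigr => m _; rewrite exprS; ring.
by rewrite gerBl exprn_ge0.
Qed.

(** Completeness, for geometrically convergent series. *)
Lemma wseries_exists (v : nat -> I -> R) C k : 0 <= k < 1 ->
  (forall m, wle w (v m) (C * k ^+ m)) ->
  exists S, wseries v S (C * (1 - k)^-1) k.
Proof.
move=> k01 vC; have /andP[k0 k1] := k01.
have C0 : 0 <= C by have := wle_ge0 (vC 0%N); rewrite expr0 mulr1.
have vi m i : `|v m i| <= C / w i * k ^+ m.
  by rewrite mulrAC ler_pdivlMr//; exact: wle_pt.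
have cv i : cvg (series (v ^~ i) @ \oo).
  apply: normed_cvg; apply: (series_le_cvg _ _ (vi^~ i)).
  - by move=> n; rewrite normr_ge0.
  - by move=> n; rewrite mulr_ge0 ?exprn_ge0// divr_ge0// ltW.
  - by apply: is_cvg_geometric_series; rewrite ger0_norm.
exists (fun i => limn (series (v ^~ i))) => M.
apply: (@wle_lim (fun n i => \sum_(M <= m < M + n) v m i)) => [i|n].
  have cvi : series (v ^~ i) @ \oo --> limn (series (v ^~ i)) := cv i.
  rewrite -(cvg_shiftn M) in cvi.
  have -> : (fun n => \sum_(M <= m < M + n) v m i) =
      fun n => series (v ^~ i) (n + M)%N - \sum_(0 <= m < M) v m i.
    apply/funext => n; rewrite /series /=.
    by rewrite (@big_cat_nat _ _ _ M 0 (n + M))//= ?leq_addl// addrAC subrr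
      add0r addnC.
  by apply: cvgB; [exact: cvi|exact: cvg_cst].
apply: (@wle_le _ _ _ (\sum_(M <= m < M + n) C * k ^+ m)).
  exact: wle_sum.
by rewrite -mulr_sumr -mulrA ler_wpM2l// sum_geo_le.
Qed.

Lemma wseries_wle (v : nat -> I -> R) S C k : wseries v S C k -> wle w S C.
Proof.
move=> /(_ 0%N); rewrite expr0 mulr1; apply: wle_mono => i.
by rewrite big_geq// subr0.
Qed.

End OneWeight.

Section TwoWeights.
Variables (I J : choiceType) (w : I -> R) (w' : J -> R).
Hypothesis w0 : forall i, 0 < w i.
Hypothesis w'0 : forall j, 0 < w' j.

Lemma opbound_entry (A : imx R I J) K i j : opbound w w' A K ->
  `|A i j| <= K / w' j * w i.
Proof.
by move=> [K0 /(_ i) /(@wle_pt _ _ _ _ j)]; rewrite mulrAC ler_pdivlMr.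
Qed.

(** The double family behind [v *m A] is summable; Fubini's theorem then gives
    both the bound on the product and associativity. *)
Lemma wle_double (v : I -> R) N (A : imx R I J) K :
  wle w v N -> opbound w w' A K ->
  (\esum_(i in [set: I]) \esum_(j in [set: J]) (`|v i * A i j| * w' j)%:E
    <= (N * K)%:E)%E.
Proof.
move=> vN [K0 AK].
apply: (@le_trans _ _ (\esum_(i in [set: I]) (K * (`|v i| * w i))%:E)%E).
  apply: le_esum => i _; have := wleZ w'0 (v i) (AK i).
  by rewrite /wle mulrCA.
rewrite esumZ//; last by move=> i; rewrite mulr_ge0// ltW.
by rewrite mulrC EFinM lee_wpmul2l// lee_fin.
Qed.

Lemma rvec_mul_asummable (v : I -> R) N (A : imx R I J) K j :
  wle w v N -> opbound w w' A K -> asummable (fun i => v i * A i j).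
Proof.
move=> vN AK; have [K0 _] := AK.
apply: (wle_pair w0 _ vN (fun i => opbound_entry i j AK)).1.
by rewrite divr_ge0// ltW.
Qed.

Lemma rvec_mul_pt (v : I -> R) N (A : imx R I J) K j :
  wle w v N -> opbound w w' A K -> `|rvec_mul v A j| <= N * (K / w' j).
Proof.
move=> vN AK; have [K0 _] := AK.
apply: (wle_pair w0 _ vN (fun i => opbound_entry i j AK)).2.
by rewrite divr_ge0// ltW.
Qed.

Lemma rvec_mul_wle (v : I -> R) N (A : imx R I J) K :
  wle w v N -> opbound w w' A K -> wle w' (rvec_mul v A) (N * K).
Proof.
move=> vN AK; have := wle_double vN AK.
rewrite esum_exchange; last by move=> i j; rewrite lee_fin mulr_ge0// ltW.
apply: le_trans; apply: le_esum => j _.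
under [leRHS]eq_esum => i _ do rewrite mulrC.
have sA := rvec_mul_asummable j vN AK.
rewrite esumZ ?(ltW (w'0 j))// mulrC EFinM lee_wpmul2l ?lee_fin ?(ltW (w'0 j))//.
rewrite -csum_ge0E//; last exact: asummable_abs.
by rewrite lee_fin; apply: normr_csum => //; exact: asummable_abs.
Qed.

Lemma rvec_mulBl (v v' : I -> R) N N' (A : imx R I J) K j :
  wle w v N -> wle w v' N' -> opbound w w' A K ->
  rvec_mul (fun i => v i - v' i) A j = rvec_mul v A j - rvec_mul v' A j.
Proof.
move=> vN vN' AK; rewrite /rvec_mul -csumB.
- by apply: eq_csum => i; rewrite mulrBl.
- exact: rvec_mul_asummable vN AK.
- exact: rvec_mul_asummable vN' AK.
Qed.

Lemma rvec_mul_suml (v : nat -> I -> R) N M (A : imx R I J) K j :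
  (forall m, wle w (v m) (N m)) -> opbound w w' A K ->
  rvec_mul (fun i => \sum_(0 <= m < M) v m i) A j =
  \sum_(0 <= m < M) rvec_mul (v m) A j.
Proof.
move=> vN AK.
rewrite -(csum_sum _ (fun m => rvec_mul_asummable j (vN m) AK)).2.
by apply: eq_csum => i; rewrite mulr_suml.
Qed.

Lemma rvec_mulDr (v : I -> R) N (A B : imx R I J) K K' j :
  wle w v N -> opbound w w' A K -> opbound w w' B K' ->
  rvec_mul v (imx_add A B) j = rvec_mul v A j + rvec_mul v B j.
Proof.
move=> vN AK BK; rewrite /rvec_mul -csumD.
- by apply: eq_csum => i; rewrite -mulrDr.
- exact: rvec_mul_asummable vN AK.
- exact: rvec_mul_asummable vN BK.
Qed.

Lemma rvec_mulZr (v : I -> R) N (A : imx R I J) K k j :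
  wle w v N -> opbound w w' A K ->
  rvec_mul v (imx_scale k A) j = k * rvec_mul v A j.
Proof.
move=> vN AK; rewrite /rvec_mul -csumZ.
- by apply: eq_csum => i; rewrite mulrCA.
- exact: rvec_mul_asummable vN AK.
Qed.

Lemma rvec_mulZl (v : I -> R) N (A : imx R I J) K k j :
  wle w v N -> opbound w w' A K ->
  rvec_mul (fun i => k * v i) A j = k * rvec_mul v A j.
Proof.
move=> vN AK; rewrite /rvec_mul -csumZ.
- by apply: eq_csum => i; rewrite mulrA.
- exact: rvec_mul_asummable vN AK.
Qed.

(** A bounded matrix may be applied term by term to a convergent series. *)
Lemma rvec_mul_series (v : nat -> I -> R) N S C k (A : imx R I J) K j :
  0 <= k < 1 -> (forall m, wle w (v m) (N m)) -> wseries w v S C k ->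
  opbound w w' A K ->
  series (fun m => rvec_mul (v m) A j) @ \oo --> rvec_mul S A j.
Proof.
move=> k01 vN vS AK; have SC := wseries_wle w0 vS.
apply/subr_cvg0; apply/norm_cvg0P.
apply: (@squeeze_cvgr _ _ _ _ (fun=> 0) (fun n => C * (K / w' j) * k ^+ n)).
- apply: nearW => n; rewrite normr_ge0 /=.
  have := rvec_mul_pt j (vS n) AK; rewrite mulrAC; apply: le_trans.
  rewrite (rvec_mulBl j SC (wle_sum w0 (index_iota 0 n) vN) AK).
  by rewrite (rvec_mul_suml n j vN AK) distrC.
- exact: cvg_cst.
- exact: geo_cvg0.
Qed.

Lemma opboundD (A B : imx R I J) K K' :
  opbound w w' A K -> opbound w w' B K' -> opbound w w' (imx_add A B) (K + K').
Proof.
move=> [K0 AK] [K'0 BK]; split; first exact: addr_ge0.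
by move=> i; rewrite mulrDl; exact: wleD.
Qed.

Lemma opboundZ (A : imx R I J) K k :
  opbound w w' A K -> opbound w w' (imx_scale k A) (`|k| * K).
Proof.
move=> [K0 AK]; split; first exact: mulr_ge0.
by move=> i; rewrite -mulrA; exact: wleZ.
Qed.

End TwoWeights.

Lemma opbound_id I (w : I -> R) : (forall i, 0 < w i) ->
  opbound w w (@imx_id R I) 1.
Proof.
move=> w0; split=> // i; rewrite mul1r /wle.
have [|s E] := @csum1 R I i (fun j => `|imx_id R i j| * w j).
  by move=> j ji; rewrite /imx_id eq_sym (negbTE ji) normr0 mul0r.
rewrite -csum_ge0E//; last by move=> j; rewrite mulr_ge0// ltW.
by rewrite E /imx_id eqxx normr1 mul1r.
Qed.

Lemma rvec_mul_id I (v : I -> R) j : rvec_mul v (@imx_id R I) j = v j.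
Proof.
rewrite /rvec_mul; have [|_ ->] := @csum1 R I j (fun i => v i * imx_id R i j).
  by move=> i /negbTE ij; rewrite /imx_id ij mulr0.
by rewrite /imx_id eqxx mulr1.
Qed.

Lemma imx_mul1 I J (A : imx R J I) : imx_mul A (@imx_id R I) = A.
Proof. by apply/funext => i; apply/funext => j; exact: rvec_mul_id. Qed.

Lemma imx_mul1l I J (A : imx R I J) : imx_mul (@imx_id R I) A = A.
Proof.
apply/funext => i; apply/funext => j; rewrite /imx_mul.
have [|_ ->] := @csum1 R I i (fun l => imx_id R i l * A l j).
  by move=> l /negbTE ij; rewrite /imx_id eq_sym ij mul0r.
by rewrite /imx_id eqxx mul1r.
Qed.

Section ThreeWeights.
Variables (I J L : choiceType) (w : I -> R) (w' : J -> R) (w'' : L -> R).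
Hypothesis w0 : forall i, 0 < w i.
Hypothesis w'0 : forall j, 0 < w' j.
Hypothesis w''0 : forall j, 0 < w'' j.

Lemma opbound_mul (A : imx R I J) (B : imx R J L) K K' :
  opbound w w' A K -> opbound w' w'' B K' ->
  opbound w w'' (imx_mul A B) (K * K').
Proof.
move=> [K0 AK] BK; split; first by case: BK => K'0 _; exact: mulr_ge0.
by move=> i; rewrite mulrAC; exact: (rvec_mul_wle w'0 w''0 (AK i) BK).
Qed.

Lemma rvec_mulA (v : I -> R) N (A : imx R I J) (B : imx R J L) K K' :
  wle w v N -> opbound w w' A K -> opbound w' w'' B K' ->
  rvec_mul (rvec_mul v A) B = rvec_mul v (imx_mul A B).
Proof.
move=> vN AK BK; apply/funext => l; have [K'0 _] := BK.
transitivity (csum (fun j => csum (fun i => v i * A i j * B j l))).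
  apply: eq_csum => j; rewrite /rvec_mul mulrC -csumZ.
    by apply: eq_csum => i; rewrite mulrC.
  exact: rvec_mul_asummable vN AK.
transitivity (csum (fun i => csum (fun j => v i * A i j * B j l))); last first.
  apply: eq_csum => i; rewrite /imx_mul -csumZ.
    by apply: eq_csum => j; rewrite mulrA.
  exact: (rvec_mul_asummable w'0 w''0 l (AK.2 i) BK).
symmetry; apply: (@csum_exchange _ _ _ _ (K' / w'' l * (N * K))).
have c0 : 0 <= K' / w'' l by rewrite divr_ge0// ltW.
rewrite EFinM; apply: le_trans (lee_wpmul2l _ (wle_double w0 w'0 vN AK)); last first.
  by rewrite lee_fin.
have a0 i j : (0 <= (`|v i * A i j| * w' j)%:E)%E by rewrite lee_fin mulr_ge0// ltW.
have -> : (\esum_(i in [set: I]) \esum_(j in [set: J]) (`|v i * A i j| * w' j)%:E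
   = \esum_(i in [set: I]) (csum (fun j => `|v i * A i j| * w' j))%:E)%E.
  apply: eq_esum => i _; rewrite csum_ge0E//; first by move=> j; have := a0 i j.
  exact: (wle_asummable w'0 (wleZ w'0 (v i) (AK.2 i))).
rewrite -esumZ//; last first.
  move=> i; apply: csum_ge0 => [j|]; first by have := a0 i j.
  exact: (wle_asummable w'0 (wleZ w'0 (v i) (AK.2 i))).
apply: le_esum => i _; rewrite EFinM csum_ge0E; first last.
- exact: (wle_asummable w'0 (wleZ w'0 (v i) (AK.2 i))).
- by move=> j; have := a0 i j.
rewrite -esumZ//; last by move=> j; have := a0 i j.
apply: le_esum => j _; rewrite lee_fin normrM mulrCA ler_wpM2l//.
exact: (opbound_entry w''0 j l BK).
Qed.

End ThreeWeights.

Lemma imx_mulA I J L (T : choiceType)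
  (w : I -> R) (w1 : J -> R) (w2 : L -> R) (w3 : T -> R)
  (A : imx R I J) (B : imx R J L) (D : imx R L T) :
  (forall j, 0 < w1 j) -> (forall j, 0 < w2 j) ->
  (forall j, 0 < w3 j) ->
  bounded_mx w w1 A -> bounded_mx w1 w2 B -> bounded_mx w2 w3 D ->
  imx_mul (imx_mul A B) D = imx_mul A (imx_mul B D).
Proof.
move=> w10 w20 w30 [K1 AK] [K2 BK] [K3 DK].
by apply/funext => i; exact: (rvec_mulA w10 w20 w30 (AK.2 i) BK DK).
Qed.

Section Powers.
Variables (I : choiceType) (w : I -> R) (A : imx R I I) (K : R).
Hypothesis w0 : forall i, 0 < w i.
Hypothesis AK : opbound w w A K.

Lemma opbound_pow m : opbound w w (imx_pow A m) (K ^+ m).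
Proof.
elim: m => [|m IH]; first exact: opbound_id.
by rewrite exprS; apply: opbound_mul.
Qed.

Lemma imx_powSr m : imx_pow A m.+1 = imx_mul (imx_pow A m) A.
Proof.
elim: m => [|m IH]; first by rewrite /imx_pow /= imx_mul1 imx_mul1l.
have Am : bounded_mx w w (imx_pow A m).
  by exists (K ^+ m); exact: opbound_pow.
have bA : bounded_mx w w A by exists K.
transitivity (imx_mul A (imx_mul (imx_pow A m) A)); first by rewrite -IH.
by rewrite -(imx_mulA w0 w0 w0 bA Am bA).
Qed.

End Powers.

End Weighted.

Arguments rvec_mul_series {R I J w w'} w0 w'0 {v N S C k A K} j _ _ _ _ {t}.

Lemma wle_asummable_ge1 (R : realType) (I : choiceType) (w v : I -> R) N :
  (forall i, 1 <= w i) -> wle w v N -> asummable v.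
Proof.
move=> w1 vN; have w0 i : 0 < w i by exact: lt_le_trans (w1 i).
apply: asummable_le (wle_asummable w0 vN) => i.
by rewrite -[leLHS]mulr1 ler_wpM2l.
Qed.

(** Convergence in the weighted norm implies convergence in the [l^1] norm. *)
Lemma wseries_l1 (R : realType) (I : choiceType) (w : I -> R)
    (v : nat -> I -> R) (S : I -> R) C k : (forall i, 1 <= w i) -> 0 <= k < 1 ->
  wseries w v S C k ->
  (fun M : nat => \esum_(i in [set: I]) `|S i - \sum_(0 <= m < M) v m i|%:E)
    @ \oo --> 0%E.
Proof.
move=> w1 k01 vS.
apply: (@squeeze_cvge _ _ _ _ (fun=> 0%E) _ (fun M => (C * k ^+ M)%:E)).
- apply: nearW => M; apply/andP; split.
    by apply: esum_ge0 => i _; rewrite lee_fin.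
  apply: le_trans (vS M); apply: le_esum => i _.
  by rewrite lee_fin -[leLHS]mulr1 ler_wpM2l.
- exact: cvg_cst.
- apply: cvg_EFin; first exact: nearW.
  exact: geo_cvg0.
Qed.

(** * Rows with finitely many nonzero entries *)

Section Sparse.
Variable R : realType.
Implicit Type I : choiceType.

(** The row vector [\sum_p p.1 e_(p.2)], the list [l] giving coefficients and
    indices. *)
Definition sparse I (l : seq (R * I)) : I -> R :=
  fun t => \sum_(p <- l) p.1 * (p.2 == t)%:R.

Lemma sparse_csum I (l : seq (R * I)) (f : I -> R) :
  asummable (fun t => sparse l t * f t) /\
  csum (fun t => sparse l t * f t) = \sum_(p <- l) p.1 * f p.2.
Proof.
pose F (p : R * I) := fun t => p.1 * (p.2 == t)%:R * f t.
have HF (p : R * I) : asummable (F p) /\ csum (F p) = p.1 * f p.2.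
  have [|s ->] := @csum1 R I p.2 (F p).
    by move=> t tp; rewrite /F eq_sym (negbTE tp) mulr0 mul0r.
  by rewrite /F eqxx mulr1.
have -> : (fun t => sparse l t * f t) = fun t => \sum_(p <- l) F p t.
  by apply/funext => t; rewrite mulr_suml.
have [s ->] := csum_sum l (fun p => (HF p).1); split => //.
by apply: eq_bigr => p _; rewrite (HF p).2.
Qed.

Lemma sparse_mul I J (l : seq (R * I)) (A : imx R I J) j :
  rvec_mul (sparse l) A j = \sum_(p <- l) p.1 * A p.2 j.
Proof. exact: (sparse_csum l (A ^~ j)).2. Qed.

Lemma imx_mul_row I J L (A : imx R I J) (B : imx R J L) i l j :
  A i = sparse l -> imx_mul A B i j = \sum_(p <- l) p.1 * B p.2 j.
Proof. by move=> Ai; rewrite -sparse_mul -Ai. Qed.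

Lemma mul_col_row I J (A : imx R I J) (f : J -> R) i l :
  A i = sparse l -> mul_col A f i = \sum_(p <- l) p.1 * f p.2.
Proof. by move=> Ai; rewrite -(sparse_csum l f).2 -Ai. Qed.

Lemma sparse_wle I (w : I -> R) (l : seq (R * I)) : (forall i, 0 < w i) ->
  wle w (sparse l) (\sum_(p <- l) `|p.1| * w p.2).
Proof.
move=> w0; apply: (wle_sum w0) => p; apply: (wleZ w0).
by have [_ /(_ p.2)] := opbound_id w0; rewrite mul1r.
Qed.

(** The function [f] as a matrix with one column. *)
Definition colmx I (f : I -> R) : imx R I unit := fun i _ => f i.

(** The constant function [1], as a matrix with one column: multiplying by it on
    the right computes row sums. *)
Definition ones I : imx R I unit := colmx (fun=> 1).

Lemma opbound_col I (w f : I -> R) (C : R) : 0 <= C ->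
  (forall i, `|f i| <= C * w i) -> opbound w (fun _ : unit => 1) (colmx f) C.
Proof.
move=> C0 fC; split => // i; rewrite /wle.
have [|s E] := @csum1 R unit tt (fun j => `|colmx f i j| * 1).
  by case.
by rewrite -csum_ge0E// E mulr1 lee_fin fC.
Qed.

End Sparse.

(** * The matrices of the polling model *)

Section Model.
Variables (R : realType) (q : rates R).
Hypotheses (hpos : positive_rates q) (hstable : stable q)
  (hscale : time_scaled q).

Lemma queueP (k : 'I_2) : k = q1 \/ k = q2.
Proof.
by case: k => [[|[|k]]] // hk; [left|right]; apply: val_inj.
Qed.

Lemma rev_q1 : rev_ord q1 = q2. Proof. exact: val_inj. Qed.
Lemma rev_q2 : rev_ord q2 = q1. Proof. exact: val_inj. Qed.

Lemma lam_gt0 i : 0 < lam q i. Proof. by have [] := hpos i. Qed.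
Lemma mu_gt0 i : 0 < mu q i. Proof. by have [] := hpos i. Qed.
Lemma cc_gt0 i : 0 < cc q i. Proof. by have [] := hpos i. Qed.
Lemma csm_gt0 : 0 < csm q. Proof. by rewrite addr_gt0 ?cc_gt0. Qed.

Lemma share_gt0 i : 0 < share q i.
Proof. by rewrite divr_gt0 ?cc_gt0 ?csm_gt0. Qed.

Lemma share_sum : share q q1 + share q q2 = 1.
Proof.
rewrite /share rev_q1 rev_q2 -mulrDl addrC divff//.
by rewrite lt0r_neq0// csm_gt0.
Qed.

(** The service rate of queue [i] in the aggregated chain. *)
Definition amu i := share q i * mu q i.

Lemma amu_gt0 i : 0 < amu i.
Proof. by rewrite mulr_gt0 ?share_gt0 ?mu_gt0. Qed.

Lemma lam_lt_amu i : lam q i < amu i.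
Proof. by have := hstable i; rewrite ltr_pdivrMr ?mu_gt0. Qed.

(** Averaging the two scaling conditions with the weights [share q] keeps the
    diagonal of the aggregated transition matrix positive. *)
Lemma aggregated_rates_lt1 :
  lam q q1 + lam q q2 + amu q1 + amu q2 < 1.
Proof.
have s12 := share_sum; rewrite /amu.
have e2 : share q q2 = 1 - share q q1 by rewrite -s12; ring.
have h k : share q k * (lam q q1 + lam q q2 + mu q k) < share q k.
  rewrite -[ltRHS]mulr1 ltr_pM2l ?share_gt0//.
  by apply: lt_le_trans (hscale k); rewrite ltrDl cc_gt0.
have := ltrD (h q1) (h q2); rewrite s12; apply: le_lt_trans.
by rewrite le_eqVlt; apply/orP; left; apply/eqP; rewrite e2; ring.
Qed.

(** The state of queue lengths after a departure from queue [k]. *)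
Definition served (n : queues) (k : 'I_2) : queues :=
  if k == q1 then (n.1.-1, n.2) else (n.1, n.2.-1).

(** The indicator of queue [k] being nonempty. *)
Definition busy (n : queues) (k : 'I_2) : R := (1 <= len n k)%N%:R.

(** The states of queue lengths after an arrival at either queue. *)
Definition up1 (n : queues) : queues := (n.1.+1, n.2).
Definition up2 (n : queues) : queues := (n.1, n.2.+1).

Lemma Wmx_row s : @Wmx R s = sparse [:: (1, s.1)].
Proof. by apply/funext => n; rewrite /sparse big_seq1 mul1r. Qed.

Lemma Vmx_row n : Vmx q n = sparse [:: (share q q1, (n, q1)); (share q q2, (n, q2))].
Proof.
apply/funext => -[m k]; rewrite /sparse !big_cons big_nil addr0 /Vmx /= !xpair_eqE.
rewrite [m == n]eq_sym; case: (n == m); last by rewrite !mulr0 addr0.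
by case: (queueP k) => ->; rewrite /= ?mulr1 ?mulr0 ?addr0 ?add0r.
Qed.

Lemma G0_row n k : G0 q (n, k) =
  sparse [:: (- cc q k, (n, k)); (cc q k, (n, rev_ord k))].
Proof.
apply/funext => -[m l]; rewrite /sparse !big_cons big_nil addr0 /G0 /= !xpair_eqE.
case: (n == m); last by rewrite !mulr0 addr0.
rewrite mxE; case: (queueP k) => ->; case: (queueP l) => ->;
  by rewrite ?rev_q1 ?rev_q2 /= ?mulr1 ?mulr0 ?addr0 ?add0r.
Qed.

Lemma G1_row n k : G1 q (n, k) = sparse
  [:: (lam q q1, (up1 n, k)); (lam q q2, (up2 n, k));
      (mu q k * busy n k, (served n k, k));
      (- (lam q q1 + lam q q2 + mu q k * busy n k), (n, k))].
Proof.
apply/funext => -[[m1 m2] l]; case: n => n1 n2.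
rewrite /sparse !big_cons big_nil addr0 /G1 /busy /served /up1 /up2 /= !xpair_eqE.
rewrite [k == l in RHS]eq_sym.
case: (queueP k) => ->; case: (queueP l) => -> /=; rewrite /len /= ?eqxx ?andbF ?andbT
  ?mulr0 ?addr0//=.
- case: n1 => [|n1] /=; rewrite ?xpair_eqE.
  + by repeat (case: eqP => /= ?; try (exfalso; lia)); ring.
  + by repeat (case: eqP => /= ?; try (exfalso; lia)); ring.
- case: n2 => [|n2] /=; rewrite ?xpair_eqE.
  + by repeat (case: eqP => /= ?; try (exfalso; lia)); ring.
  + by repeat (case: eqP => /= ?; try (exfalso; lia)); ring.
Qed.

Lemma Gam_row n : Gam q n = sparse
  [:: (lam q q1, up1 n); (lam q q2, up2 n);
      (amu q1 * busy n q1, served n q1); (amu q2 * busy n q2, served n q2);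
      (- (lam q q1 + lam q q2 + amu q1 * busy n q1 + amu q2 * busy n q2), n)].
Proof.
apply/funext => m; rewrite /Gam /imx_mul /=.
have E t : csum (fun j => Vmx q n j * G1 q j t) =
    share q q1 * G1 q (n, q1) t + share q q2 * G1 q (n, q2) t.
  have := sparse_mul [:: (share q q1, (n, q1)); (share q q2, (n, q2))] (G1 q) t.
  by rewrite -Vmx_row /rvec_mul => ->; rewrite !big_cons big_nil addr0.
under eq_csum => t do rewrite E mulrDl -(mulrA (share q q1)) -(mulrA (share q q2)).
have S k : asummable (fun t => G1 q (n, k) t * @Wmx R t m).
  by rewrite G1_row; exact: (sparse_csum _ ((@Wmx R)^~ m)).1.
have C k : csum (fun t => G1 q (n, k) t * @Wmx R t m) =
   lam q q1 * (up1 n == m)%:R + (lam q q2 * (up2 n == m)%:R +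
   (mu q k * busy n k * (served n k == m)%:R +
    - (lam q q1 + lam q q2 + mu q k * busy n k) * (n == m)%:R)).
  rewrite G1_row [LHS](sparse_csum _ ((@Wmx R)^~ m)).2.
  by rewrite !big_cons big_nil addr0.
rewrite csumD; [|exact: (asummableZ _ (S q1))|exact: (asummableZ _ (S q2))].
rewrite (csumZ _ (S q1)) (csumZ _ (S q2)) !C /sparse !big_cons big_nil addr0 /= /amu.
have -> : share q q2 = 1 - share q q1 by rewrite -share_sum; ring.
ring.
Qed.

Lemma Pbar_row n : Pbar q n = sparse
  [:: (1, n); (lam q q1, up1 n); (lam q q2, up2 n);
      (amu q1 * busy n q1, served n q1); (amu q2 * busy n q2, served n q2);
      (- (lam q q1 + lam q q2 + amu q1 * busy n q1 + amu q2 * busy n q2), n)].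
Proof.
apply/funext => m; rewrite /Pbar /imx_add Gam_row /sparse [in RHS]big_cons.
by rewrite mul1r.
Qed.

(** * The deviation matrix of the unperturbed chain *)

Lemma G0E n k t :
  G0 q (n, k) t = cc q k * (@imx_id R _ (n, rev_ord k) t - @imx_id R _ (n, k) t).
Proof.
rewrite G0_row /sparse !big_cons big_nil addr0 /imx_id /=; ring.
Qed.

Lemma G0_mul J (B : imx R (nat * nat * 'I_2)%type J) n k j :
  imx_mul (G0 q) B (n, k) j = cc q k * (B (n, rev_ord k) j - B (n, k) j).
Proof.
rewrite (imx_mul_row _ _ (G0_row n k)) !big_cons big_nil /=; ring.
Qed.

Lemma P0_row n k : P0 q (n, k) =
  sparse [:: (1, (n, k)); (- cc q k, (n, k)); (cc q k, (n, rev_ord k))].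
Proof.
apply/funext => m; rewrite /P0 /imx_add G0_row /sparse [in RHS]big_cons.
by rewrite mul1r.
Qed.

Lemma G0_rev n k t :
  cc q k * G0 q (n, rev_ord k) t = - (cc q (rev_ord k) * G0 q (n, k) t).
Proof. rewrite !G0E rev_ordK; ring. Qed.

Lemma cc_rev k : cc q k + cc q (rev_ord k) = csm q.
Proof.
by case: (queueP k) => ->; rewrite ?rev_q1 ?rev_q2 /csm// addrC.
Qed.

Lemma G0_G0 : imx_mul (G0 q) (G0 q) = imx_scale (- csm q) (G0 q).
Proof.
apply/funext => -[n k]; apply/funext => t.
by rewrite G0_mul mulrBr G0_rev /imx_scale -(cc_rev k); ring.
Qed.

(** Since [G0] is, up to the factor [- csm q], a projection, the powers of [P0]
    stay in the span of the identity and [G0]. *)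
Lemma P0_pow m : imx_pow (P0 q) m =
  imx_add (@imx_id R _) (imx_scale ((1 - (1 - csm q) ^+ m) / csm q) (G0 q)).
Proof.
have c0 : csm q != 0 by rewrite lt0r_neq0// csm_gt0.
elim: m => [|m IH].
  apply/funext => s; apply/funext => t.
  by rewrite /imx_add /imx_scale expr0 subrr !mul0r addr0.
apply/funext => -[n k]; apply/funext => t.
transitivity (imx_mul (P0 q) (imx_pow (P0 q) m) (n, k) t); first by [].
rewrite IH (imx_mul_row _ _ (P0_row n k)) !big_cons big_nil /=.
rewrite /imx_add /imx_scale.
rewrite exprS !G0E rev_ordK; move: c0; set p := _ ^+ m; rewrite -(cc_rev k) => c0.
by field.
Qed.

Lemma P0_deviation : is_deviation_matrix (P0 q)
  (imx_add (@imx_id R _) (imx_scale (csm q)^-1 (G0 q))) (Hmx q).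
Proof.
have c0 := csm_gt0; move=> s t.
have c1 : `|1 - csm q| < 1.
  have h k : cc q k < 1.
    apply: lt_le_trans (hscale k); rewrite ltrDr.
    by rewrite !addr_gt0 ?lam_gt0 ?mu_gt0.
  by have := h q1; have := h q2; move: c0; rewrite /csm ltr_norml; lra.
have := @cvg_geometric_series R (- (csm q)^-1 * G0 q s t) _ c1.
rewrite subKr.
rewrite (_ : _ / csm q = Hmx q s t); last first.
  by rewrite /Hmx /imx_scale; field; exact: lt0r_neq0.
apply: cvg_trans; apply: near_eq_cvg; apply: nearW => n.
apply: eq_bigr => m _; rewrite P0_pow /imx_add /imx_scale /geometric /=.
by field; exact: lt0r_neq0.
Qed.

End Model.

(** A convergent series of deviations from [l] forces the averages of the
    sequence to converge to [l]. *)
Lemma deviation_cesaro (R : realType) (a : nat -> R) (l d : R) :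
  series (fun m => a m - l) @ \oo --> d ->
  (fun n : nat => n%:R^-1 * \sum_(1 <= m < n.+1) a m) @ \oo --> l.
Proof.
move=> H; rewrite -(cvg_shiftS _ (nbhs l)).
have E (n : nat) : n.+1%:R^-1 * \sum_(1 <= m < n.+2) a m =
    n.+1%:R^-1 * (series (fun m => a m - l) (n + 2)%N - (a 0%N - l)) + l.
  rewrite /series /= addn2 [in RHS]big_ltn// addrAC subrr add0r sumrB.
  by rewrite sumr_const_nat subn1 /= mulrBr -[l *+ n.+1]mulr_natl mulKf ?subrK//.
have : (fun n : nat => n.+1%:R^-1 *
    (series (fun m => a m - l) (n + 2)%N - (a 0%N - l)) + l) @ \oo -->
    0 * (d - (a 0%N - l)) + l.
  apply: cvgD; last exact: cvg_cst.
  apply: cvgM; first exact: cvg_harmonic.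
  apply: cvgB; last exact: cvg_cst.
  by rewrite (cvg_shiftn 2 (series (fun m => a m - l))).
rewrite mul0r add0r; apply: cvg_trans; apply: near_eq_cvg; apply: nearW => n.
exact/esym/E.
Qed.

Lemma deviation_ergodic (R : realType) (I : choiceType) (P Q D : imx R I I) :
  is_deviation_matrix P Q D -> is_ergodic_projection P Q.
Proof. by move=> H i j; apply: deviation_cesaro (H i j). Qed.

(** * Contraction of the aggregated chain *)

(** One step of a random walk in the quarter plane acts on the increments [D] of
    a function along the first axis as written below; the increments stay
    within the same envelope, multiplied by [kap]. *)
Lemma edge_contraction (R : realType) (l1 l2 a1 a2 r1 r2 A L kap : R)
    (D : nat -> nat -> R) :
  0 <= l1 -> 0 <= l2 -> 0 <= a1 -> 0 <= a2 -> l1 + l2 + a1 + a2 <= 1 ->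
  1 < r1 -> 1 < r2 -> 0 <= A -> 0 <= L -> l2 * r2 <= a2 ->
  1 - (r1 - 1) * (a1 / r1 - l1) <= kap ->
  (1 - (r1 - 1) * (a1 / r1 - l1)) * (1 + A) + l2 * (r2 - 1) <= kap * (1 + A) ->
  (forall n m, `|D n m| <= L * (r1 ^+ n * (r2 ^+ m + A))) ->
  forall n m,
   `|D n m * (1 - l1 - l2 - a1 - a2) + l1 * D n.+1 m + l2 * D n m.+1 +
     (if n is n'.+1 then a1 * D n' m else 0) + a2 * D n m.-1|
   <= kap * L * (r1 ^+ n * (r2 ^+ m + A)).
Proof.
move=> l10 l20 a10 a20 s1 r11 r21 A0 L0 h2 hk1 hk2 HD n m.
have r10 : 0 < r1 by apply: lt_trans r11.
have r20 : 0 < r2 by apply: lt_trans r21.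
have dK (r x : R) : 0 < r -> r * x / r = x.
  by move=> r0; field; exact: lt0r_neq0.
have X0 : 0 < r1 ^+ n by rewrite exprn_gt0.
have Y1 : 1 <= r2 ^+ m by rewrite exprn_ege1// ltW.
set X := r1 ^+ n in X0 *; set Y := r2 ^+ m in Y1 *.
have b0 : `|D n m * (1 - l1 - l2 - a1 - a2)| <=
    L * (X * (Y + A)) * (1 - l1 - l2 - a1 - a2).
  have s0 : 0 <= 1 - l1 - l2 - a1 - a2 by lra.
  by rewrite normrM (ger0_norm s0) ler_wpM2r.
have b1 : `|l1 * D n.+1 m| <= l1 * (L * (r1 * X * (Y + A))).
  by rewrite normrM (ger0_norm l10) ler_wpM2l// -exprS.
have b2 : `|l2 * D n m.+1| <= l2 * (L * (X * (r2 * Y + A))).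
  by rewrite normrM (ger0_norm l20) ler_wpM2l// -exprS.
have b3 : `|if n is n'.+1 then a1 * D n' m else 0| <=
    a1 * (L * (X / r1 * (Y + A))).
  rewrite /X; case: n {X X0 b0 b1 b2} => [|n].
    rewrite normr0 !mulr_ge0 ?invr_ge0 ?expr0 ?addr_ge0 ?(ltW r10)//.
    exact: le_trans Y1.
  by rewrite normrM (ger0_norm a10) ler_wpM2l// exprS dK.
pose Y' := if m is 0%N then 1 else Y / r2.
have b4 : `|a2 * D n m.-1| <= a2 * (L * (X * (Y' + A))).
  rewrite normrM (ger0_norm a20) ler_wpM2l// /Y' /Y.
  case: m {Y Y1 b0 b1 b2 b3 Y'} => [|m] /=; first by rewrite (le_trans (HD _ _)).
  by rewrite exprS dK.
have key : (Y + A) * (1 - l1 - l2 - a1 - a2) + l1 * (r1 * (Y + A)) +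
   l2 * (r2 * Y + A) + a1 * (1 / r1 * (Y + A)) + a2 * (Y' + A) <= kap * (Y + A).
  set th := (r1 - 1) * (a1 / r1 - l1) in hk1 hk2.
  have -> : (Y + A) * (1 - l1 - l2 - a1 - a2) + l1 * (r1 * (Y + A)) +
   l2 * (r2 * Y + A) + a1 * (1 / r1 * (Y + A)) + a2 * (Y' + A) =
   (1 - th) * (Y + A) + l2 * (r2 - 1) * Y - a2 * (Y - Y').
    by rewrite /th; field; exact: lt0r_neq0.
  rewrite /Y' /Y; case: m {b0 b1 b2 b3 b4 Y' Y Y1} => [|m].
    by rewrite expr0 subrr mulr0 subr0 mulr1.
  set Z := r2 ^+ m.+1; have Z0 : 0 <= Z by rewrite exprn_ge0// ltW.
  have : l2 * (r2 - 1) * Z <= a2 * (Z - Z / r2).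
    rewrite (_ : a2 * (Z - Z / r2) = a2 / r2 * (r2 - 1) * Z); last first.
      by field; exact: lt0r_neq0.
    rewrite ler_wpM2r// ler_wpM2r ?subr_ge0 ?(ltW r21)//.
    by rewrite ler_pdivlMr.
  have : (1 - th) * (Z + A) <= kap * (Z + A) by rewrite ler_wpM2r// addr_ge0.
  lra.
have := ler_wpM2l (mulr_ge0 L0 (ltW X0)) key.
set T0 := D n m * _ in b0 *; set T1 := l1 * D _ _ in b1 *.
set T2 := l2 * D _ _ in b2 *; set T3 := (X in `|X| <= _) in b3.
set T4 := a2 * D _ _ in b4 *.
have n4 := ler_normD (T0 + T1 + T2 + T3) T4.
have n3 := ler_normD (T0 + T1 + T2) T3.
have n2 := ler_normD (T0 + T1) T2; have n1 := ler_normD T0 T1.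
have -> : kap * L * (X * (Y + A)) = L * X * (kap * (Y + A)) by ring.
apply: le_trans; apply: (le_trans n4).
rewrite (_ : L * X * _ = L * (X * (Y + A)) * (1 - l1 - l2 - a1 - a2) +
   l1 * (L * (r1 * X * (Y + A))) + l2 * (L * (X * (r2 * Y + A))) +
   a1 * (L * (X / r1 * (Y + A))) + a2 * (L * (X * (Y' + A)))); last by ring.
lra.
Qed.

Section Contraction.
Variables (R : realType) (q : rates R).
Hypotheses (hpos : positive_rates q) (hstable : stable q)
  (hscale : time_scaled q).

(** The geometric growth rates of the weights: [1 < growth i] and
    [lam q i * growth i < amu q i]. *)
Definition growth i : R := (1 + amu q i / lam q i) / 2.

Lemma growth_gt1 i : 1 < growth i.
Proof.
have h : 1 < amu q i / lam q i.
  by rewrite ltr_pdivlMr ?mul1r ?(lam_gt0 hpos)// lam_lt_amu.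
by rewrite /growth; lra.
Qed.

Lemma growth_gt0 i : 0 < growth i.
Proof. exact: lt_trans (growth_gt1 i). Qed.

Lemma lam_growth i : lam q i * growth i < amu q i.
Proof.
have -> : lam q i * growth i = (lam q i + amu q i) / 2.
  by rewrite /growth; field; rewrite lt0r_neq0// (lam_gt0 hpos).
by have := lam_lt_amu hpos hstable i; lra.
Qed.

(** The relative mean decrease, in one step, of [growth i ^+ n] for [0 < n]. *)
Definition drift i : R := (growth i - 1) * (amu q i / growth i - lam q i).

Lemma drift_gt0 i : 0 < drift i.
Proof.
rewrite mulr_gt0// subr_gt0 ?growth_gt1//.
by rewrite ltr_pdivlMr ?growth_gt0// lam_growth.
Qed.

Lemma drift_le i : drift i <= amu q i.
Proof.
have g1 := growth_gt1 i; have g0 := growth_gt0 i; have l0 := lam_gt0 hpos i.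
have -> : drift i = amu q i - amu q i / growth i - lam q i * (growth i - 1).
  by rewrite /drift; field; exact: lt0r_neq0.
have := amu_gt0 hpos i => a0.
have : 0 <= amu q i / growth i by rewrite divr_ge0 ?(ltW a0) ?(ltW g0).
have : 0 <= lam q i * (growth i - 1).
  by rewrite mulr_ge0 ?subr_ge0 ?(ltW l0) ?(ltW g1).
lra.
Qed.

Lemma contraction_params : exists A kap : R, [/\ 0 <= A, 0 <= kap < 1,
  forall i, 1 - drift i <= kap &
  forall i, (1 - drift i) * (1 + A)
     + lam q (rev_ord i) * (growth (rev_ord i) - 1) <= kap * (1 + A)].
Proof.
(* With [A >= B i], the growth of the other factor at an empty queue costs at
   most half of the drift. *)
pose B i := 2 * lam q (rev_ord i) * (growth (rev_ord i) - 1) / drift i.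
have B0 i : 0 <= B i.
  have l0 := lam_gt0 hpos (rev_ord i); have d0 := drift_gt0 i.
  have g0 : 0 <= growth (rev_ord i) - 1 by rewrite subr_ge0 ltW// growth_gt1.
  by rewrite divr_ge0 ?(ltW d0)// mulr_ge0// mulr_ge0// ltW.
pose kap := Num.max (1 - drift q1 / 2) (1 - drift q2 / 2).
have hk i : 1 - drift i / 2 <= kap.
  by case: (queueP i) => ->; rewrite /kap le_max lexx ?orbT.
have hA i : B i <= B q1 + B q2.
  by have := B0 q1; have := B0 q2; case: (queueP i) => ->; lra.
exists (B q1 + B q2), kap; split.
- exact: addr_ge0.
- have := aggregated_rates_lt1 hpos hscale.
  have := drift_le q1; have := amu_gt0 hpos q2; have := lam_gt0 hpos q1.
  have := lam_gt0 hpos q2; have := hk q1; have := drift_gt0 q1; have := drift_gt0 q2.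
  rewrite /kap gt_max => *; apply/andP; split; first lra.
  by apply/andP; split; lra.
- by move=> i; have := hk i; have := drift_gt0 i; lra.
move=> i; have := hA i; set A := B q1 + B q2 => Ai.
have A0 : 0 <= A by exact: addr_ge0.
apply: (@le_trans _ _ ((1 - drift i / 2) * (1 + A))); last first.
  by rewrite ler_wpM2r ?hk//; lra.
have : lam q (rev_ord i) * (growth (rev_ord i) - 1) = B i * drift i / 2.
  by rewrite /B; field; rewrite lt0r_neq0 ?drift_gt0.
move=> ->; have := drift_gt0 i => d0.
have : B i * drift i <= A * drift i by rewrite ler_wpM2r// ltW.
lra.
Qed.

Lemma mul_col_Pbar (f : nat * nat -> R) n : mul_col (Pbar q) f n =
  f n + lam q q1 * (f (up1 n) - f n) + lam q q2 * (f (up2 n) - f n)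
  + amu q q1 * busy R n q1 * (f (served n q1) - f n)
  + amu q q2 * busy R n q2 * (f (served n q2) - f n).
Proof.
rewrite (mul_col_row _ (Pbar_row hpos n)) !big_cons big_nil /=; ring.
Qed.

(** The increments of [f] along both axes are at most [L] times the lengths
    [growth q1 ^+ n1 * (growth q2 ^+ n2 + A)] and
    [growth q2 ^+ n2 * (growth q1 ^+ n1 + A)] of the edges of the grid. The
    constant [A] makes up for the growth of one factor while the other queue is
    empty. *)
Definition lip (A : R) (f : nat * nat -> R) (L : R) : Prop := forall n m,
  `|f (n.+1, m) - f (n, m)| <= L * (growth q1 ^+ n * (growth q2 ^+ m + A)) /\
  `|f (n, m.+1) - f (n, m)| <= L * (growth q2 ^+ m * (growth q1 ^+ n + A)).

(** One step of the aggregated chain contracts the seminorm [lip A]. *)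
Lemma lip_step A kap f L : 0 <= A -> 0 <= L ->
  (forall i, 1 - drift i <= kap) ->
  (forall i, (1 - drift i) * (1 + A)
     + lam q (rev_ord i) * (growth (rev_ord i) - 1) <= kap * (1 + A)) ->
  lip A f L -> lip A (mul_col (Pbar q) f) (kap * L).
Proof.
move=> A0 L0 h1 h2 fL n m.
have l0 i := ltW (lam_gt0 hpos i); have a0 i := ltW (amu_gt0 hpos i).
have s1 := ltW (aggregated_rates_lt1 hpos hscale).
have := h2 q1; rewrite rev_q1 => h21; have := h2 q2; rewrite rev_q2 => h22.
rewrite !mul_col_Pbar /busy /served /up1 /up2 /len /=; split.
- have := @edge_contraction R (lam q q1) (lam q q2) (amu q q1) (amu q q2)
    (growth q1) (growth q2) A L kap (fun n m => f (n.+1, m) - f (n, m))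
    (l0 _) (l0 _) (a0 _) (a0 _) s1 (growth_gt1 _) (growth_gt1 _) A0 L0
    (ltW (lam_growth _)) (h1 q1) h21 (fun n m => (fL n m).1) n m.
  apply: le_trans; rewrite le_eqVlt; apply/orP; left; apply/eqP; congr (`|_|).
  by case: n => [|n]; case: m => [|m] /=; ring.
- have s2 : lam q q2 + lam q q1 + amu q q2 + amu q q1 <= 1 by lra.
  have := @edge_contraction R (lam q q2) (lam q q1) (amu q q2) (amu q q1)
    (growth q2) (growth q1) A L kap (fun m n => f (n, m.+1) - f (n, m))
    (l0 _) (l0 _) (a0 _) (a0 _) s2 (growth_gt1 _) (growth_gt1 _) A0 L0
    (ltW (lam_growth _)) (h1 q2) h22 (fun m n => (fL n m).2) m n.
  apply: le_trans; rewrite le_eqVlt; apply/orP; left; apply/eqP; congr (`|_|).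
  by case: n => [|n]; case: m => [|m] /=; ring.
Qed.

(** The weight of a pair of queue lengths. *)
Definition wq (n : nat * nat) : R := growth q1 ^+ n.1 * growth q2 ^+ n.2.

Lemma wq_ge1 n : 1 <= wq n.
Proof. by rewrite mulr_ege1// exprn_ege1// ltW// growth_gt1. Qed.

Lemma wq_gt0 n : 0 < wq n.
Proof. exact: lt_le_trans (wq_ge1 n). Qed.

Lemma wq_lip A f : 0 <= A -> (forall n, `|f n| <= wq n) ->
  lip A f (2 + growth q1 + growth q2).
Proof.
move=> A0 fw n m.
have g1 := growth_gt0 q1; have g2 := growth_gt0 q2.
have x0 : 0 <= growth q1 ^+ n by rewrite exprn_ge0// ltW.
have y0 : 0 <= growth q2 ^+ m by rewrite exprn_ge0// ltW.
have xy : 0 <= growth q1 ^+ n * growth q2 ^+ m by exact: mulr_ge0.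
have xA : 0 <= growth q1 ^+ n * A by exact: mulr_ge0.
have yA : 0 <= growth q2 ^+ m * A by exact: mulr_ge0.
have xyg i : 0 <= growth i * (growth q1 ^+ n * growth q2 ^+ m).
  by rewrite mulr_ge0// ltW// growth_gt0.
have xAg i : 0 <= growth i * (growth q1 ^+ n * A).
  by rewrite mulr_ge0// ltW// growth_gt0.
have yAg i : 0 <= growth i * (growth q2 ^+ m * A).
  by rewrite mulr_ge0// ltW// growth_gt0.
have := xyg q1; have := xyg q2; have := xAg q1; have := xAg q2.
have := yAg q1; have := yAg q2 => *.
have f0 := fw (n, m); rewrite /wq /= in f0; split.
- have f1 := fw (n.+1, m); rewrite /wq /= exprS in f1.
  apply: (le_trans (ler_normB _ _)); apply: (le_trans (lerD f1 f0)); lra.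
- have f1 := fw (n, m.+1); rewrite /wq /= exprS in f1.
  apply: (le_trans (ler_normB _ _)); apply: (le_trans (lerD f1 f0)); lra.
Qed.

(** Summing increments along a grid path to the origin. *)
Lemma lip_dist A f L : 0 <= A -> 0 <= L -> lip A f L -> forall n,
  `|f n - f (0, 0)%N| <=
    L * ((1 + A) * ((growth q1 - 1)^-1 + (growth q2 - 1)^-1)) * wq n.
Proof.
move=> A0 L0 fL [n m].
have g1 := growth_gt1 q1; have g2 := growth_gt1 q2.
have d1 : 0 < growth q1 - 1 by rewrite subr_gt0.
have d2 : 0 < growth q2 - 1 by rewrite subr_gt0.
have i1 : 0 < (growth q1 - 1)^-1 by rewrite invr_gt0.
have i2 : 0 < (growth q2 - 1)^-1 by rewrite invr_gt0.
have H1 : `|f (n, m) - f (0%N, m)| <=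
    L * ((growth q2 ^+ m + A) * ((growth q1 ^+ n - 1) * (growth q1 - 1)^-1)).
  elim: n => [|n IH]; first by rewrite subrr normr0 expr0 subrr mul0r !mulr0.
  rewrite -(subrKA (f (n, m))); apply: (le_trans (ler_normD _ _)).
  apply: (le_trans (lerD (fL n m).1 IH)).
  rewrite le_eqVlt; apply/orP; left; apply/eqP; rewrite exprS; field.
  exact: lt0r_neq0.
have H2 : `|f (0%N, m) - f (0, 0)%N| <=
    L * ((1 + A) * ((growth q2 ^+ m - 1) * (growth q2 - 1)^-1)).
  elim: m {H1} => [|m IH]; first by rewrite subrr normr0 expr0 subrr mul0r !mulr0.
  rewrite -(subrKA (f (0%N, m))); apply: (le_trans (ler_normD _ _)).
  apply: (le_trans (lerD (fL 0%N m).2 IH)).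
  rewrite le_eqVlt; apply/orP; left; apply/eqP; rewrite exprS expr0; field.
  exact: lt0r_neq0.
rewrite -(subrKA (f (0%N, m))); apply: (le_trans (ler_normD _ _)).
apply: (le_trans (lerD H1 H2)).
have x1 : 1 <= growth q1 ^+ n by rewrite exprn_ege1// ltW.
have y1 : 1 <= growth q2 ^+ m by rewrite exprn_ege1// ltW.
rewrite -mulrDr -mulrA ler_wpM2l// /wq /=.
set X := growth q1 ^+ n in x1 *; set Y := growth q2 ^+ m in y1 *.
set J1 := _^-1 in i1 *; set J2 := _^-1 in i2 *.
rewrite mulrDr mulrDl lerD//.
- have : (Y + A) * ((X - 1) * J1) <= ((1 + A) * Y) * (X * J1).
    apply: ler_pM.
    + by rewrite addr_ge0// (le_trans _ y1).
    + by rewrite mulr_ge0 ?subr_ge0// ltW.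
    + have := ler_wpM2l A0 y1; rewrite mulr1; lra.
    + by rewrite ler_wpM2r ?gerBl// ltW.
  by congr (_ <= _); ring.
- have : (1 + A) * ((Y - 1) * J2) <= (1 + A) * (X * Y * J2).
    rewrite ler_wpM2l//; first by rewrite addr_ge0.
    rewrite ler_wpM2r ?(ltW i2)//.
    have : 1 * Y <= X * Y by rewrite ler_wpM2r// (le_trans _ y1).
    lra.
  by congr (_ <= _); ring.
Qed.

End Contraction.

(** * Geometric ergodicity of the aggregated chain *)

Section GeometricSums.
Variable R : realType.

Lemma esum_geometric (z : R) : 0 <= z < 1 ->
  \esum_(n in [set: nat]) (z ^+ n)%:E = ((1 - z)^-1)%:E.
Proof.
move=> /andP[z0 z1]; rewrite -nneseries_esumT; last first.
  by move=> n; rewrite lee_fin exprn_ge0.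
apply: cvg_lim => //; apply: cvg_EFin.
  by apply: nearW => n; rewrite sumEFin.
have := @cvg_geometric_series R 1 z; rewrite ger0_norm// => /(_ z1).
rewrite mul1r; apply: cvg_trans; apply: near_eq_cvg; apply: nearW => n /=.
by rewrite sumEFin /series /=; apply: eq_bigr => i _; rewrite mul1r.
Qed.

Lemma esum_geometric2 (c z1 z2 : R) : 0 <= c -> 0 <= z1 < 1 -> 0 <= z2 < 1 ->
  \esum_(n in [set: nat * nat]) (c * (z1 ^+ n.1 * z2 ^+ n.2))%:E =
  (c * ((1 - z1)^-1 * (1 - z2)^-1))%:E.
Proof.
move=> c0 z1P z2P; have /andP[z10 _] := z1P; have /andP[z20 _] := z2P.
have -> : [set: nat * nat] = [set: nat] `*`` (fun=> [set: nat]).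
  by apply/seteqP; split.
rewrite -(@esum_esum _ _ _ [set: nat] (fun=> [set: nat])
  (fun i j => (c * (z1 ^+ i * z2 ^+ j))%:E)); last first.
  by move=> i j _ _; rewrite lee_fin !mulr_ge0// exprn_ge0.
have -> : \esum_(i in [set: nat]) \esum_(j in [set: nat])
    (c * (z1 ^+ i * z2 ^+ j))%:E =
    \esum_(i in [set: nat]) ((c * (1 - z2)^-1) * z1 ^+ i)%:E.
  apply: eq_esum => i _; rewrite mulrAC EFinM -esum_geometric// -esumZ.
  - by apply: eq_esum => j _; rewrite mulrA.
  - by rewrite mulr_ge0// exprn_ge0.
  - by move=> j; rewrite exprn_ge0.
rewrite esumZ.
- by rewrite esum_geometric// -EFinM mulrAC mulrA.
- by rewrite mulr_ge0// invr_ge0 subr_ge0 ltW//; case/andP: z2P.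
- by move=> j; rewrite exprn_ge0.
Qed.

Lemma fsum_le_csum (I : choiceType) (h : I -> R) (F : set I) : finite_set F ->
  (forall i, 0 <= h i) -> asummable h -> \sum_(i \in F) h i <= csum h.
Proof.
move=> finF h0 sh; rewrite -lee_fin -fsumEFin// csum_ge0E//.
by apply: ereal_sup_ubound; exists F.
Qed.

End GeometricSums.

Section Ergodicity.
Variables (R : realType) (q : rates R).
Hypotheses (hpos : positive_rates q) (hstable : stable q)
  (hscale : time_scaled q).

Local Notation w := (wq q).
Let wq0 : forall n, 0 < w n := wq_gt0 hpos hstable.

Lemma rhot_amu i : rhot q i = lam q i / amu q i.
Proof.
have c1 := lt0r_neq0 (cc_gt0 hpos q1); have c2 := lt0r_neq0 (cc_gt0 hpos q2).
have c := lt0r_neq0 (csm_gt0 hpos); have m := lt0r_neq0 (mu_gt0 hpos i).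
rewrite /rhot /amu /share.
case: (queueP i) m => -> m; rewrite ?rev_q1 ?rev_q2; field.
  by rewrite c m c2 c1.
by rewrite c m c2 c1.
Qed.

Lemma rhot_gt0 i : 0 < rhot q i.
Proof. by rewrite rhot_amu divr_gt0 ?(lam_gt0 hpos) ?(amu_gt0 hpos). Qed.

Lemma rhot_lt1 i : rhot q i < 1.
Proof.
by rewrite rhot_amu ltr_pdivrMr ?mul1r ?(amu_gt0 hpos)// lam_lt_amu.
Qed.

Lemma rhot_growth i : 0 <= rhot q i * growth q i < 1.
Proof.
rewrite mulr_ge0 ?(ltW (rhot_gt0 i)) ?(ltW (growth_gt0 hpos hstable i))//=.
by rewrite rhot_amu mulrAC ltr_pdivrMr ?mul1r ?(amu_gt0 hpos)// lam_growth.
Qed.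

Lemma pibar_gt0 n : 0 < pibar q n.
Proof.
by rewrite !mulr_gt0 ?exprn_gt0 ?subr_gt0 ?rhot_lt1 ?rhot_gt0.
Qed.

(** The [wq]-norm of the stationary measure [pibar]. *)
Definition pibar_norm : R := (1 - rhot q q1) * (1 - rhot q q2) *
  ((1 - rhot q q1 * growth q q1)^-1 * (1 - rhot q q2 * growth q q2)^-1).

Lemma pibar_wle : wle w (pibar q) pibar_norm.
Proof.
rewrite /wle /pibar_norm -esum_geometric2 ?rhot_growth//; last first.
  by rewrite mulr_ge0// subr_ge0 ltW// rhot_lt1.
apply: le_esum => n _; rewrite lee_fin gtr0_norm ?pibar_gt0// /pibar /wq.
rewrite !exprMn le_eqVlt; apply/orP; left; apply/eqP; ring.
Qed.

Lemma pibar_esum : \esum_(n in [set: nat * nat]) (pibar q n)%:E = 1%E.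
Proof.
have r0 i := rhot_gt0 i; have r1 i := rhot_lt1 i.
have n0 i : 1 - rhot q i != 0 by rewrite lt0r_neq0// subr_gt0.
transitivity (\esum_(n in [set: nat * nat]) ((1 - rhot q q1) * (1 - rhot q q2) *
    (rhot q q1 ^+ n.1 * rhot q q2 ^+ n.2))%:E).
  by apply: eq_esum => n _; congr EFin; rewrite /pibar; ring.
rewrite esum_geometric2 ?r1 ?(ltW (r0 _))//; last first.
  by rewrite mulr_ge0// subr_ge0 ltW.
by congr EFin; field; rewrite !n0.
Qed.

Lemma pibar_asummable : asummable (pibar q).
Proof.
apply: (@asummable_esum _ _ _ 1).
under eq_esum => n _ do rewrite gtr0_norm ?pibar_gt0//.
by rewrite pibar_esum.
Qed.

Lemma pibar_csum : csum (pibar q) = 1.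
Proof.
have p0 n : 0 <= pibar q n by rewrite ltW// pibar_gt0.
by apply: EFin_inj; rewrite (csum_ge0E p0 pibar_asummable) pibar_esum.
Qed.

Lemma rhot_mul_amu i : rhot q i * amu q i = lam q i.
Proof. by rewrite rhot_amu divfK// lt0r_neq0// (amu_gt0 hpos). Qed.

Lemma balance_up1 n m : pibar q n * (lam q q1 * (up1 n == m)%:R) =
  pibar q m * (amu q q1 * busy R m q1 * (served m q1 == n)%:R).
Proof.
have [<-|nm] := eqVneq (up1 n) m.
  rewrite /served /busy /len /= -surjective_pairing eqxx !mulr1 -rhot_mul_amu.
  rewrite /pibar /= exprS; ring.
rewrite !mulr0; case: m nm => -[|m1] m2 nm.
  by rewrite /busy /len /= mulr0 mul0r mulr0.
have [E|] := eqVneq (served (m1.+1, m2) q1) n; last by rewrite !mulr0.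
by move: nm; rewrite -E /up1 /served /= eqxx.
Qed.

Lemma balance_up2 n m : pibar q n * (lam q q2 * (up2 n == m)%:R) =
  pibar q m * (amu q q2 * busy R m q2 * (served m q2 == n)%:R).
Proof.
have [<-|nm] := eqVneq (up2 n) m.
  rewrite /served /busy /len /= -surjective_pairing eqxx !mulr1 -rhot_mul_amu.
  rewrite /pibar /= exprS; ring.
rewrite !mulr0; case: m nm => m1 [|m2] nm.
  by rewrite /busy /len /= mulr0 mul0r mulr0.
have [E|] := eqVneq (served (m1, m2.+1) q2) n; last by rewrite !mulr0.
by move: nm; rewrite -E /up2 /served /= eqxx.
Qed.

(** The aggregated chain is reversible. *)
Lemma detailed_balance n m :
  pibar q n * Gam q n m = pibar q m * Gam q m n.
Proof.
have [<-//|nm] := eqVneq n m.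
rewrite !(Gam_row hpos) /sparse !big_cons !big_nil /=.
rewrite [m == n]eq_sym (negbTE nm) !mulr0 !addr0 !mulrDr.
rewrite !balance_up1 !balance_up2; ring.
Qed.

Lemma wq_up1 n : w (up1 n) = growth q q1 * w n.
Proof. by rewrite /wq /= exprS mulrA. Qed.

Lemma wq_up2 n : w (up2 n) = growth q q2 * w n.
Proof. by rewrite /wq /= exprS mulrCA. Qed.

Lemma wq_served n k : w (served n k) <= w n.
Proof.
have g0 i := ltW (growth_gt0 hpos hstable i).
have g1 i := ltW (growth_gt1 hpos hstable i).
rewrite /served; case: ifP => _; rewrite /wq /=.
  by rewrite ler_wpM2r ?exprn_ge0// ler_weXn2l ?g1// leq_pred.
by rewrite ler_wpM2l ?exprn_ge0// ler_weXn2l ?g1// leq_pred.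
Qed.

Lemma busy_01 n k : 0 <= busy R n k <= 1.
Proof. by rewrite /busy; case: (_ <= _)%N; rewrite ?lexx ?ler01. Qed.

Lemma Gam_bounded : bounded_mx w w (Gam q).
Proof.
have l0 i := ltW (lam_gt0 hpos i); have a0 i := ltW (amu_gt0 hpos i).
have g0 i := ltW (growth_gt0 hpos hstable i).
exists (lam q q1 * growth q q1 + lam q q2 * growth q q2 + amu q q1 + amu q q2 +
  (lam q q1 + lam q q2 + amu q q1 + amu q q2)).
have m0 i := mulr_ge0 (l0 i) (g0 i).
split; first by rewrite !addr_ge0 ?m0 ?l0 ?a0.
move=> n; rewrite (Gam_row hpos).
apply: (wle_le (sparse_wle _ wq0)); rewrite !big_cons big_nil /= normrN.
have ab k : 0 <= amu q k * busy R n k <= amu q k.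
  have /andP[b0 b1] := busy_01 n k; rewrite mulr_ge0//=.
  by rewrite -[leRHS]mulr1 ler_wpM2l.
have /andP[s1 s2] := ab q1; have /andP[t1 t2] := ab q2.
rewrite !ger0_norm ?addr_ge0// wq_up1 wq_up2.
have := ler_pM s1 (ltW (wq0 _)) s2 (wq_served n q1).
have := ler_pM t1 (ltW (wq0 _)) t2 (wq_served n q2).
have := ler_wpM2r (ltW (wq0 n)) s2.
have := ler_wpM2r (ltW (wq0 n)) t2.
lra.
Qed.

Lemma Pbar_bounded : bounded_mx w w (Pbar q).
Proof.
have [K GK] := Gam_bounded; exists (1 + K); apply: opboundD => //.
exact: opbound_id.
Qed.

Lemma pibar_Gam : rvec_mul (pibar q) (Gam q) = fun=> 0.
Proof.
apply/funext => j; rewrite /rvec_mul.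
under eq_csum => n do rewrite detailed_balance.
have [s E] := sparse_csum
  [:: (lam q q1, up1 j); (lam q q2, up2 j);
      (amu q q1 * busy R j q1, served j q1); (amu q q2 * busy R j q2, served j q2);
      (- (lam q q1 + lam q q2 + amu q q1 * busy R j q1 + amu q q2 * busy R j q2), j)]
  (fun=> 1).
rewrite -(Gam_row hpos) in s E.
have e n : Gam q j n = Gam q j n * 1 by rewrite mulr1.
under eq_csum => n do rewrite e.
rewrite csumZ// E !big_cons big_nil /=; ring.
Qed.

Lemma pibar_Pbar m : rvec_mul (pibar q) (imx_pow (Pbar q) m) = pibar q.
Proof.
have [K PK] := Pbar_bounded; have [K' GK] := Gam_bounded.
elim: m => [|m IH]; first by apply/funext => j; exact: rvec_mul_id.
rewrite [imx_pow _ _]/(imx_mul (Pbar q) (imx_pow (Pbar q) m)).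
rewrite -(rvec_mulA wq0 wq0 wq0 pibar_wle PK (opbound_pow wq0 PK m)).
rewrite (_ : rvec_mul _ (Pbar q) = pibar q)//; apply/funext => j.
rewrite (rvec_mulDr wq0 wq0 j pibar_wle (opbound_id wq0) GK).
by rewrite rvec_mul_id pibar_Gam addr0.
Qed.

(** Geometric ergodicity in the [wq]-norm. By duality it suffices to test the
    difference of the two measures on functions [f] bounded by [wq]. Such an [f]
    has bounded increments in the sense of [lip], so the increments of [P^m f]
    are of order [kap ^+ m]; as [pibar] is invariant, the difference of the two
    integrals of [f] is an average of increments of [P^m f]. *)
Lemma aggregated_ergodic : exists C kap : R, [/\ 0 <= C, 0 <= kap < 1 &
  forall m i, wle w (fun j => imx_pow (Pbar q) m i j - pibar q j)
    (C * w i * kap ^+ m)].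
Proof.
have [A [kap [A0 kap01 h1 h2]]] := contraction_params hpos hstable hscale.
have /andP[kap0 kap1] := kap01.
have [K PK] := Pbar_bounded.
pose L0 : R := 2 + growth q q1 + growth q q2.
have L00 : 0 <= L0.
  by rewrite !addr_ge0// ltW// (growth_gt0 hpos hstable).
pose Cd : R := (1 + A) * ((growth q q1 - 1)^-1 + (growth q q2 - 1)^-1).
have Cd0 : 0 <= Cd.
  rewrite mulr_ge0 ?addr_ge0// ?invr_ge0 subr_ge0 ltW//; exact: growth_gt1.
have N0 := wle_ge0 pibar_wle.
exists (L0 * Cd * (1 + pibar_norm)), kap; split => //.
  exact: mulr_ge0 (mulr_ge0 L00 Cd0) (addr_ge0 ler01 N0).
move=> m i; apply: wle_finite => F finF.
(* The extremal test function for the finite set [F]. *)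
pose f j := if j \in F then
  Num.sg (imx_pow (Pbar q) m i j - pibar q j) * w j else 0.
have fw j : `|f j| <= w j.
  rewrite /f; case: ifP => _; last by rewrite normr0 ltW.
  rewrite normrM normr_sg (gtr0_norm (wq0 _)); case: (_ != 0); rewrite ?mul1r//.
  by rewrite mul0r ltW.
have fK : opbound w (fun _ : unit => 1) (colmx f) 1.
  by apply: opbound_col => // j; rewrite mul1r.
pose g n j := imx_mul (imx_pow (Pbar q) n) (colmx f) j tt.
have gS n : g n.+1 = mul_col (Pbar q) (g n).
  apply/funext => j; rewrite /g.
  rewrite [imx_pow _ n.+1]/(imx_mul (Pbar q) (imx_pow (Pbar q) n)).
  rewrite (@imx_mulA _ _ _ _ _ w w w (fun=> 1))//.
  - by exists K.
  - by exists (K ^+ n); exact: opbound_pow.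
  - by exists 1.
have gl n : lip q A (g n) (kap ^+ n * L0).
  elim: n => [|n IH].
    rewrite expr0 mul1r.
    have -> : g 0%N = f by apply/funext => j; rewrite /g imx_mul1l.
    exact: wq_lip.
  rewrite gS exprS -mulrA; apply: lip_step => //.
  by rewrite mulr_ge0// exprn_ge0.
have gd j : `|g m j - g m (0, 0)%N| <= kap ^+ m * L0 * Cd * w j.
  by apply: lip_dist => //; rewrite mulr_ge0// exprn_ge0.
have [s1 b1] := wle_pair wq0 (mulr_ge0 (mulr_ge0 (exprn_ge0 m kap0) L00) Cd0)
  pibar_wle gd.
have Pm := opbound_pow wq0 PK m.
have gK : opbound w (fun _ : unit => 1) (colmx (g m)) (K ^+ m * 1).
  by have [k0 H] := opbound_mul wq0 (fun=> ltr01) Pm fK; split.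
have sf := rvec_mul_asummable wq0 (fun=> ltr01) tt pibar_wle fK.
have sg := rvec_mul_asummable wq0 (fun=> ltr01) tt pibar_wle gK.
have sP := rvec_mul_asummable wq0 (fun=> ltr01) tt (Pm.2 i) fK.
have pg : csum (fun j => pibar q j * g m j) = csum (fun j => pibar q j * f j).
  have := rvec_mulA wq0 wq0 (fun=> ltr01) pibar_wle Pm fK.
  by rewrite pibar_Pbar => /(congr1 (@^~ tt)) /esym.
have E : csum (fun j => (imx_pow (Pbar q) m i j - pibar q j) * f j) =
    (g m i - g m (0, 0)%N) - csum (fun j => pibar q j * (g m j - g m (0, 0)%N)).
  have -> : csum (fun j => pibar q j * (g m j - g m (0, 0)%N)) =
      csum (fun j => pibar q j * f j) - g m (0, 0)%N.
    rewrite -pg -[g m (0, 0)%N]mulr1 -[X in _ - _ * X]pibar_csum -csumZ; last first.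
      exact: pibar_asummable.
    rewrite -csumB//; last exact: (asummableZ _ pibar_asummable).
    by apply: eq_csum => j; rewrite mulr1 mulrBr [X in _ - X]mulrC.
  transitivity (g m i - csum (fun j => pibar q j * f j)); last by ring.
  rewrite -(csumB sP sf); apply: eq_csum => j; exact: mulrBl.
have [Ef0 sE] : (forall j, 0 <= (imx_pow (Pbar q) m i j - pibar q j) * f j) /\
    asummable (fun j => (imx_pow (Pbar q) m i j - pibar q j) * f j).
  split.
    move=> j; rewrite /f; case: ifP => _; last by rewrite mulr0.
    by rewrite mulrA [_ * Num.sg _]mulrC -normrEsg mulr_ge0// ltW.
  rewrite (_ : (fun j => _) = (fun j => imx_pow (Pbar q) m i j * f j -
    pibar q j * f j)); first exact: (summableB sP sf).
  by apply/funext => j; rewrite mulrBl.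
have -> : \sum_(j \in F) `|imx_pow (Pbar q) m i j - pibar q j| * w j =
   \sum_(j \in F) (imx_pow (Pbar q) m i j - pibar q j) * f j.
  apply: eq_fsbigr => j jF; rewrite /f jF [RHS]mulrA; congr (_ * _).
  by rewrite mulrC -normrEsg.
apply: (le_trans (fsum_le_csum finF Ef0 sE)); rewrite E.
apply: (le_trans (ler_norm _)); apply: (le_trans (ler_normB _ _)).
apply: (le_trans (lerD (gd i) b1)).
set Q := kap ^+ m * L0 * Cd.
have -> : L0 * Cd * (1 + pibar_norm) * w i * kap ^+ m =
   Q * w i + pibar_norm * Q * w i by rewrite /Q; ring.
rewrite lerD2l -[leLHS]mulr1 ler_wpM2l ?wq_ge1//.
exact: mulr_ge0 N0 (mulr_ge0 (mulr_ge0 (exprn_ge0 m kap0) L00) Cd0).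
Qed.

End Ergodicity.

(** * Invariant signed measures of irreducible stochastic matrices *)

Section InvariantSign.
Variables (R : realType) (I : choiceType) (P : imx R I I).
Hypotheses (P_ge0 : forall i j, 0 <= P i j) (P_sum : forall i, asummable (P i))
  (P_stoch : forall i, csum (P i) = 1).
Hypothesis P_irr : forall Z : I -> Prop,
  (forall s t, Z t -> 0 < P s t -> Z s) -> forall s t, Z t -> Z s.

Let one : I -> R := fun=> 1.
Let one0 : forall i, 0 < one i := fun=> ltr01.

Lemma asummable_wle1 (v : I -> R) :
  asummable v -> wle one v (csum (fun i => `|v i|)).
Proof.
move=> sv; rewrite /wle csum_ge0E//; last exact: asummable_abs.
by apply: le_esum => i _; rewrite mulr1.
Qed.

Let P1 : opbound one one P 1.
Proof.
split => // i; rewrite /one mulr1.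
have := asummable_wle1 (P_sum i).
by under eq_csum => j do rewrite ger0_norm//; rewrite P_stoch.
Qed.

(** The positive part of an invariant vector is invariant too, since
    [v^+ <= v^+ P] while both sides have the same total mass. By irreducibility
    it vanishes everywhere as soon as it vanishes somewhere. *)
Lemma invariant_nonpos (v : I -> R) : asummable v -> (forall j, rvec_mul v P j = v j) ->
  forall t, v t <= 0 -> forall s, v s <= 0.
Proof.
move=> sv vP t vt s.
pose vp i := Num.max (v i) 0.
have vp0 i : 0 <= vp i by rewrite /vp le_max lexx orbT.
have svp : asummable vp by exact: asummable_max0.
have vpN := asummable_wle1 svp; have vN := asummable_wle1 sv.
have svpP j := rvec_mul_asummable one0 one0 j vpN P1.
have svP j := rvec_mul_asummable one0 one0 j vN P1.
have le_vpP j : vp j <= rvec_mul vp P j.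
  rewrite /vp ge_max; apply/andP; split.
    rewrite -[leLHS]vP; apply: le_csum => // i.
    by rewrite ler_wpM2r// /vp le_max lexx.
  by apply: (csum_ge0 _ (svpP j)) => i; exact: mulr_ge0.
have svpP' : asummable (rvec_mul vp P).
  have := wle_asummable one0 (rvec_mul_wle one0 one0 vpN P1).
  by apply: asummable_le => i; rewrite mulr1.
have mass : csum (rvec_mul vp P) = csum vp.
  have o1 : opbound one (fun _ : unit => 1) (@ones R I) 1.
    by apply: opbound_col => // i; rewrite mulr1 normr1.
  have := rvec_mulA one0 one0 (fun=> ltr01) vpN P1 o1.
  move=> /(congr1 (@^~ tt)); rewrite /rvec_mul => H.
  rewrite (_ : csum (rvec_mul vp P) =
    csum (fun i => csum (fun i0 => vp i0 * P i0 i) * ones R i tt)); last first.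
    by apply: eq_csum => i; rewrite mulr1.
  rewrite H; apply: eq_csum => i; rewrite /imx_mul.
  rewrite (_ : csum _ = 1) ?mulr1// -(P_stoch i).
  by apply: eq_csum => j; rewrite mulr1.
have inv j : rvec_mul vp P j = vp j.
  apply/eqP; rewrite -subr_eq0; apply/eqP.
  apply: (csum_ge0_eq0 (f := fun j => rvec_mul vp P j - vp j)).
  - by move=> i; rewrite subr_ge0.
  - exact: (summableB svpP' svp).
  - by rewrite csumB// mass subrr.
have step i j : vp j = 0 -> 0 < P i j -> vp i = 0.
  move=> vj Pij; have := inv j; rewrite vj.
  move=> /(csum_ge0_eq0 (fun i => mulr_ge0 (vp0 i) (P_ge0 i j)) (svpP j)) /(_ i).
  by move/eqP; rewrite mulf_eq0 (gt_eqF Pij) orbF => /eqP.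
have vt0 : vp t = 0 by rewrite /vp; apply/max_idPr.
have Zs := @P_irr (fun s => vp s = 0) step s t vt0.
by rewrite -Zs /vp le_max lexx.
Qed.

End InvariantSign.

(** * The perturbed chain is stochastic and irreducible *)

Section Perturbed.
Variables (R : realType) (q : rates R) (e : R).
Hypotheses (hpos : positive_rates q) (hscale : time_scaled q).

Lemma Peps_row n k : Peps q e (n, k) = sparse
  [:: (1, (n, k)); (- cc q k, (n, k)); (cc q k, (n, rev_ord k));
      (e * lam q q1, (up1 n, k)); (e * lam q q2, (up2 n, k));
      (e * (mu q k * busy R n k), (served n k, k));
      (- (e * (lam q q1 + lam q q2 + mu q k * busy R n k)), (n, k))].
Proof.
apply/funext => t; rewrite /Peps /imx_add /imx_scale G0_row G1_row /sparse.
rewrite !big_cons !big_nil /imx_id /=; ring.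
Qed.

Lemma Peps_rowsum s : asummable (Peps q e s) /\ csum (Peps q e s) = 1.
Proof.
case: s => n k.
have [s E] := sparse_csum ([:: (1, (n, k)); (- cc q k, (n, k)); (cc q k, (n, rev_ord k));
      (e * lam q q1, (up1 n, k)); (e * lam q q2, (up2 n, k));
      (e * (mu q k * busy R n k), (served n k, k));
      (- (e * (lam q q1 + lam q q2 + mu q k * busy R n k)), (n, k))]) (fun=> 1).
rewrite -Peps_row in s E.
have e1 : (fun t => Peps q e (n, k) t * 1) = Peps q e (n, k).
  by apply/funext => t; rewrite mulr1.
rewrite e1 in s E; split => //; rewrite E !big_cons big_nil /=; ring.
Qed.

Hypotheses (e_gt0 : 0 < e) (e_le1 : e <= 1).

Lemma Peps_ge n k t :
  cc q k * ((n, rev_ord k) == t)%:R + e * lam q q1 * ((up1 n, k) == t)%:R +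
  e * lam q q2 * ((up2 n, k) == t)%:R +
  e * (mu q k * busy R n k) * ((served n k, k) == t)%:R <= Peps q e (n, k) t.
Proof.
have h := hscale k; have l1 := lam_gt0 hpos q1; have l2 := lam_gt0 hpos q2.
have m0 := mu_gt0 hpos k.
have d0 : 0 <= 1 - cc q k - e * (lam q q1 + lam q q2 + mu q k * busy R n k).
  have bm : mu q k * busy R n k <= mu q k.
    by rewrite -[leRHS]mulr1 ler_wpM2l ?(ltW m0)// /busy; case: (_ <= _)%N.
  have m1 : 0 <= mu q k * busy R n k.
    by rewrite mulr_ge0 ?(ltW m0)// /busy; case: (_ <= _)%N.
  have : e * (lam q q1 + lam q q2 + mu q k * busy R n k) <=
      1 * (lam q q1 + lam q q2 + mu q k * busy R n k).
    by rewrite ler_wpM2r// !addr_ge0// ltW.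
  lra.
have : 0 <= (1 - cc q k - e * (lam q q1 + lam q q2 + mu q k * busy R n k)) *
   ((n, k) == t)%:R by rewrite mulr_ge0.
rewrite Peps_row /sparse !big_cons big_nil /=; lra.
Qed.

Lemma Peps_pos n k t : let terms :=
  [/\ 0 <= cc q k * ((n, rev_ord k) == t)%:R,
    0 <= e * lam q q1 * ((up1 n, k) == t)%:R,
    0 <= e * lam q q2 * ((up2 n, k) == t)%:R &
    0 <= e * (mu q k * busy R n k) * ((served n k, k) == t)%:R] in terms.
Proof.
have b0 : 0 <= busy R n k by rewrite /busy; case: (_ <= _)%N.
split; rewrite mulr_ge0//.
- exact: ltW (cc_gt0 hpos k).
- exact: mulr_ge0 (ltW e_gt0) (ltW (lam_gt0 hpos _)).
- exact: mulr_ge0 (ltW e_gt0) (ltW (lam_gt0 hpos _)).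
- exact: mulr_ge0 (ltW e_gt0) (mulr_ge0 (ltW (mu_gt0 hpos _)) b0).
Qed.

Lemma Peps_ge0 s t : 0 <= Peps q e s t.
Proof.
case: s => n k; have [h1 h2 h3 h4] := Peps_pos n k t.
by apply: le_trans (Peps_ge n k t); rewrite !addr_ge0.
Qed.

Lemma Peps_switch n k : 0 < Peps q e (n, k) (n, rev_ord k).
Proof.
have [_ h2 h3 h4] := Peps_pos n k (n, rev_ord k).
apply: lt_le_trans (Peps_ge n k _); rewrite eqxx mulr1.
have := cc_gt0 hpos k; lra.
Qed.

Lemma Peps_up1 n k : 0 < Peps q e (n, k) (up1 n, k).
Proof.
have [h1 _ h3 h4] := Peps_pos n k (up1 n, k).
apply: lt_le_trans (Peps_ge n k _); rewrite eqxx mulr1.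
have := mulr_gt0 e_gt0 (lam_gt0 hpos q1); lra.
Qed.

Lemma Peps_up2 n k : 0 < Peps q e (n, k) (up2 n, k).
Proof.
have [h1 h2 _ h4] := Peps_pos n k (up2 n, k).
apply: lt_le_trans (Peps_ge n k _); rewrite eqxx mulr1.
have := mulr_gt0 e_gt0 (lam_gt0 hpos q2); lra.
Qed.

Lemma Peps_served n k : (0 < len n k)%N -> 0 < Peps q e (n, k) (served n k, k).
Proof.
move=> nk; have [h1 h2 h3 _] := Peps_pos n k (served n k, k).
apply: lt_le_trans (Peps_ge n k _); rewrite eqxx /busy nk !mulr1.
have := mulr_gt0 e_gt0 (mu_gt0 hpos k); lra.
Qed.

Lemma Peps_irr (Z : nat * nat * 'I_2 -> Prop) :
  (forall s t, Z t -> 0 < Peps q e s t -> Z s) -> forall s t, Z t -> Z s.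
Proof.
move=> ZP.
have Zk n k l : Z (n, k) -> Z (n, l).
  move=> Zn; have [->//|kl] := eqVneq l k.
  apply: ZP Zn _; have -> : k = rev_ord l; last exact: Peps_switch.
  by case: (queueP k) kl => ->; case: (queueP l) => ->; rewrite ?rev_q1 ?rev_q2.
have down n m k : Z (n, m, k) -> Z (0, 0, k)%N.
  elim: n => [|n IH] Zn.
    elim: m Zn => [//|m IH] Zm; apply: IH.
    by apply: ZP Zm _; exact: (Peps_up2 (0%N, m)).
  by apply: IH; apply: ZP Zn _; exact: (Peps_up1 (n, m)).
have up n m k : Z (0, 0, k)%N -> Z (n, m, k).
  move=> Z0; elim: n => [|n IH].
    elim: m => [//|m IH]; apply: (Zk _ q2); apply: ZP (Zk _ _ q2 IH) _.
    exact: (@Peps_served (0%N, m.+1) q2).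
  apply: (Zk _ q1); apply: ZP (Zk _ _ q1 IH) _.
  exact: (@Peps_served (n.+1, m) q1).
move=> [[n m] k] [[n' m'] l] /down /Zk Z0; exact/up/Z0.
Qed.

End Perturbed.

(** A summable invariant vector of total mass one is a probability measure, and
    the only invariant one: were one of its entries negative, all of them would
    be nonpositive; and the difference of two invariant probability measures has a
    constant sign and total mass zero. *)
Lemma invariant_prob_unique (R : realType) (q : rates R) (e : R)
    (S : nat * nat * 'I_2 -> R) :
  positive_rates q -> time_scaled q -> 0 < e -> e <= 1 ->
  asummable S -> csum S = 1 -> (forall s, rvec_mul S (Peps q e) s = S s) ->
  invariant_prob (Peps q e) S /\
  forall p, invariant_prob (Peps q e) p -> forall s, p s = S s.
Proof.
move=> hpos hscale e0 e1 sS S1 SP.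
have P0 s t : 0 <= Peps q e s t by exact: Peps_ge0.
have Ps s : asummable (Peps q e s) by have [] := Peps_rowsum q e s.
have P1 s : csum (Peps q e s) = 1 by have [] := Peps_rowsum q e s.
have Pirr := Peps_irr hpos hscale e0 e1.
have sgn v := @invariant_nonpos _ _ _ P0 Ps P1 Pirr v.
have S0 s : 0 <= S s.
  have [//|/ltW Ss] := lerP 0 (S s).
  have : csum S <= csum (fun _ : nat * nat * 'I_2 => 0 : R).
    by apply: le_csum => //; [exact: sgn SP _ Ss|exact: (csum_cst0 _ _).1].
  by rewrite S1 (csum_cst0 _ _).2 ler10.
split.
  by split => //; rewrite -csum_ge0E// S1.
move=> p [p0 p1 pP] s.
have sp : asummable p.
  apply: (@asummable_esum _ _ _ 1).
  by under eq_esum => t _ do rewrite ger0_norm//; rewrite p1.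
have cp : csum p = 1 by apply: EFin_inj; rewrite csum_ge0E.
have one0 (t : nat * nat * 'I_2) : 0 < 1 :> R by exact: ltr01.
have P11 : opbound (fun=> 1) (fun=> 1) (Peps q e) 1.
  split => // t; rewrite mulr1 /wle.
  have -> : 1%:E = (csum (Peps q e t))%:E by rewrite P1.
  rewrite csum_ge0E//; apply: le_esum => t' _.
  by rewrite mulr1 ger0_norm.
have key (v v' : nat * nat * 'I_2 -> R) : asummable v -> asummable v' ->
    csum v = csum v' -> (forall t, rvec_mul v (Peps q e) t = v t) ->
    (forall t, rvec_mul v' (Peps q e) t = v' t) -> v s <= v' s ->
    v s = v' s.
  move=> sv sv' vv vP v'P vs.
  pose d t := v t - v' t.
  have sd : asummable d by exact: (summableB sv sv').
  have dP t : rvec_mul d (Peps q e) t = d t.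
    rewrite (rvec_mulBl one0 one0 t (asummable_wle1 sv) (asummable_wle1 sv') P11).
    by rewrite vP v'P.
  have ds : d s <= 0 by rewrite /d subr_le0.
  have d0 := sgn d sd dP s ds.
  have := @csum_ge0_eq0 _ _ (fun t => v' t - v t) _ (summableB sv' sv).
  rewrite csumB// vv subrr => H; apply/eqP; rewrite eq_sym -subr_eq0 H// => t.
  by have := d0 t; rewrite /d subr_le0 subr_ge0.
have [ps|/ltW ps] := lerP (p s) (S s).
  by apply: key; rewrite ?cp ?S1.
by apply/esym; apply: key; rewrite ?cp ?S1.
Qed.

(** * The deviation matrix of the aggregated chain *)

Section MatrixAlgebra.
Variable R : realType.
Implicit Types I J L : choiceType.

Lemma imx_mul0 I J L (A : imx R I J) :
  imx_mul A (fun (_ : J) (_ : L) => 0) = fun _ _ => 0.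
Proof.
apply/funext => i; apply/funext => j; rewrite /imx_mul.
by under eq_csum => l do rewrite mulr0; rewrite (csum_cst0 R J).2.
Qed.

Lemma rvec_mul0 I J (v : I -> R) :
  rvec_mul v (fun (_ : I) (_ : J) => 0) = fun=> 0.
Proof.
apply/funext => j; rewrite /rvec_mul.
by under eq_csum => l do rewrite mulr0; rewrite (csum_cst0 R I).2.
Qed.

Lemma imx_mulZl I J L (w : I -> R) (w1 : J -> R) (w2 : L -> R) k
    (A : imx R I J) (B : imx R J L) :
  (forall j, 0 < w1 j) -> (forall j, 0 < w2 j) ->
  bounded_mx w w1 A -> bounded_mx w1 w2 B ->
  imx_mul (imx_scale k A) B = imx_scale k (imx_mul A B).
Proof.
move=> w10 w20 [K AK] [K' BK]; apply/funext => i; apply/funext => j.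
exact: (rvec_mulZl w10 w20 k j (AK.2 i) BK).
Qed.

Lemma imx_mulDl I J L (w : I -> R) (w1 : J -> R) (w2 : L -> R)
    (A A' : imx R I J) (B : imx R J L) :
  (forall j, 0 < w1 j) -> (forall j, 0 < w2 j) ->
  bounded_mx w w1 A -> bounded_mx w w1 A' -> bounded_mx w1 w2 B ->
  imx_mul (imx_add A A') B = imx_add (imx_mul A B) (imx_mul A' B).
Proof.
move=> w10 w20 [K AK] [K1 AK'] [K' BK]; apply/funext => i; apply/funext => j.
rewrite /imx_add /imx_mul -csumD.
- by apply: eq_csum => l; rewrite mulrDl.
- exact: (rvec_mul_asummable w10 w20 j (AK.2 i) BK).
- exact: (rvec_mul_asummable w10 w20 j (AK'.2 i) BK).
Qed.

Lemma imx_mulDr I J L (w : I -> R) (w1 : J -> R) (w2 : L -> R)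
    (A : imx R I J) (B B' : imx R J L) :
  (forall j, 0 < w1 j) -> (forall j, 0 < w2 j) ->
  bounded_mx w w1 A -> bounded_mx w1 w2 B -> bounded_mx w1 w2 B' ->
  imx_mul A (imx_add B B') = imx_add (imx_mul A B) (imx_mul A B').
Proof.
move=> w10 w20 [K AK] [K1 BK'] [K' BK]; apply/funext => i; apply/funext => j.
exact: (rvec_mulDr w10 w20 j (AK.2 i) BK' BK).
Qed.

Lemma imx_mulZr I J L (w : I -> R) (w1 : J -> R) (w2 : L -> R) k
    (A : imx R I J) (B : imx R J L) :
  (forall j, 0 < w1 j) -> (forall j, 0 < w2 j) ->
  bounded_mx w w1 A -> bounded_mx w1 w2 B ->
  imx_mul A (imx_scale k B) = imx_scale k (imx_mul A B).
Proof.
move=> w10 w20 [K AK] [K' BK]; apply/funext => i; apply/funext => j.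
exact: (rvec_mulZr w10 w20 k j (AK.2 i) BK).
Qed.

Lemma bounded_mul I J L (w : I -> R) (w1 : J -> R) (w2 : L -> R)
    (A : imx R I J) (B : imx R J L) :
  (forall j, 0 < w1 j) -> (forall j, 0 < w2 j) ->
  bounded_mx w w1 A -> bounded_mx w1 w2 B -> bounded_mx w w2 (imx_mul A B).
Proof.
by move=> w10 w20 [K AK] [K' BK]; exists (K * K'); apply: opbound_mul AK BK.
Qed.

Lemma bounded_add I J (w : I -> R) (w1 : J -> R) (A B : imx R I J) :
  (forall j, 0 < w1 j) ->
  bounded_mx w w1 A -> bounded_mx w w1 B -> bounded_mx w w1 (imx_add A B).
Proof.
by move=> w10 [K AK] [K' BK]; exists (K + K'); apply: opboundD AK BK.
Qed.

Lemma bounded_scale I J (w : I -> R) (w1 : J -> R) k (A : imx R I J) :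
  (forall j, 0 < w1 j) ->
  bounded_mx w w1 A -> bounded_mx w w1 (imx_scale k A).
Proof. by move=> w10 [K AK]; exists (`|k| * K); apply: opboundZ AK. Qed.

Lemma bounded_id I (w : I -> R) : (forall j, 0 < w j) ->
  bounded_mx w w (@imx_id R I).
Proof. by move=> w0; exists 1; exact: opbound_id. Qed.

Lemma bounded_ones I (w : I -> R) : (forall i, 1 <= w i) ->
  bounded_mx w (fun _ : unit => 1) (@ones R I).
Proof.
by move=> w1; exists 1; apply: opbound_col => // i; rewrite normr1 mul1r.
Qed.

End MatrixAlgebra.

Section Deviation.
Variables (R : realType) (q : rates R).
Hypotheses (hpos : positive_rates q) (hstable : stable q)
  (hscale : time_scaled q).

Local Notation w := (wq q).
Let w0 : forall n, 0 < w n := wq_gt0 hpos hstable.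
Let u0 (u : unit) : 0 < 1 :> R := ltr01.

(** The ergodic projection of the aggregated chain. *)
Definition gam : imx R (nat * nat)%type (nat * nat)%type := fun _ => pibar q.

Lemma Gam_ones : imx_mul (Gam q) (@ones R _) = fun _ _ => 0.
Proof.
apply/funext => n; apply/funext => -[].
rewrite (imx_mul_row _ _ (Gam_row hpos n)) !big_cons big_nil /ones /colmx /=; ring.
Qed.

Lemma Pbar_pow_ones m : imx_mul (imx_pow (Pbar q) m) (@ones R _) = @ones R _.
Proof.
have bP := Pbar_bounded hpos hstable; have [K PK] := bP.
have bO := bounded_ones (wq_ge1 hpos hstable).
have bPm k : bounded_mx w w (imx_pow (Pbar q) k).
  by exists (K ^+ k); exact: opbound_pow.
elim: m => [|m IH]; first exact: imx_mul1l.
rewrite [imx_pow _ _]/(imx_mul (Pbar q) (imx_pow (Pbar q) m)).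
rewrite (imx_mulA w0 w0 u0 bP (bPm m) bO) IH.
rewrite (imx_mulDl w0 u0 (bounded_id w0) (Gam_bounded hpos hstable) bO).
rewrite imx_mul1l Gam_ones; apply/funext => n; apply/funext => j.
by rewrite /imx_add addr0.
Qed.

(** The deviation matrix of the aggregated chain exists, is bounded, inverts
    [- Gam q] up to the ergodic projection, and has zero row sums. *)
Lemma aggregated_deviation : exists Phi : imx R (nat * nat)%type (nat * nat)%type,
  [/\ is_deviation_matrix (Pbar q) gam Phi, bounded_mx w w Phi,
      imx_mul Phi (Gam q) = imx_add gam (imx_scale (-1) (@imx_id R _)) &
      imx_mul Phi (@ones R _) = fun _ _ => 0].
Proof.
have [C [kap [C0 kap01 H]]] := aggregated_ergodic hpos hstable hscale.
have /andP[kap0 kap1] := kap01.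
have bP := Pbar_bounded hpos hstable; have [K PK] := bP.
have [KG GK] := Gam_bounded hpos hstable.
have [KO OK] := bounded_ones (wq_ge1 hpos hstable).
have vS i : exists S, wseries w (fun m j => imx_pow (Pbar q) m i j - pibar q j)
    S (C * w i * (1 - kap)^-1) kap.
  by apply: wseries_exists => // m; exact: H.
have [Phi PhiS] := choice vS.
have cvPhi : is_deviation_matrix (Pbar q) gam Phi.
  move=> i j.
  have := rvec_mul_series w0 w0 j kap01 (fun m => H m i) (PhiS i) (opbound_id w0).
  rewrite rvec_mul_id; apply: cvg_trans; apply: near_eq_cvg; apply: nearW => n.
  by apply: eq_bigr => m _; rewrite rvec_mul_id.
exists Phi; split => //.
- exists (C * (1 - kap)^-1); split.
    by rewrite mulr_ge0// invr_ge0 subr_ge0 ltW.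
  by move=> i; rewrite mulrAC; exact: wseries_wle (PhiS i).
- apply/funext => i; apply/funext => j.
  have := rvec_mul_series w0 w0 j kap01 (fun m => H m i) (PhiS i) GK.
  have E m : rvec_mul (fun j => imx_pow (Pbar q) m i j - pibar q j) (Gam q) j =
      imx_pow (Pbar q) m.+1 i j - imx_pow (Pbar q) m i j.
    have Pm := (opbound_pow w0 PK m).2 i.
    rewrite (rvec_mulBl w0 w0 j Pm (pibar_wle hpos hstable) GK).
    rewrite pibar_Gam// subr0 (imx_powSr w0 PK).
    have := rvec_mulDr w0 w0 j Pm (opbound_id w0) GK.
    rewrite rvec_mul_id -/(Pbar q) => PE.
    by rewrite [imx_mul _ _ i j]PE addrAC subrr add0r.
  have T n : series (fun m => rvec_mul (fun j => imx_pow (Pbar q) m i j -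
      pibar q j) (Gam q) j) n = imx_pow (Pbar q) n i j - @imx_id R _ i j.
    rewrite /series /=; under eq_bigr => m _ do rewrite E.
    by rewrite telescope_sumr.
  have cvP : (fun n => imx_pow (Pbar q) n i j - @imx_id R _ i j) @ \oo -->
      pibar q j - @imx_id R _ i j.
    apply: cvgB; last exact: cvg_cst.
    have cv := cvPhi i j.
    have /cvg_series_cvg_0/subr_cvg0 := cvgP _ cv; exact.
  rewrite (funext T) => cv; rewrite /imx_add /imx_scale mulN1r.
  by apply: cvg_unique cv cvP.
- apply/funext => i; apply/funext => -[].
  have := rvec_mul_series w0 u0 tt kap01 (fun m => H m i) (PhiS i) OK.
  have T : series (fun m => rvec_mul (fun j => imx_pow (Pbar q) m i j -
      pibar q j) (@ones R _) tt) = fun=> 0.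
    apply/funext => n; rewrite /series /= big1// => m _.
    have Pm := (opbound_pow w0 PK m).2 i.
    rewrite (rvec_mulBl w0 u0 tt Pm (pibar_wle hpos hstable) OK).
    rewrite -[rvec_mul (imx_pow (Pbar q) m i) _ _]/(imx_mul (imx_pow (Pbar q) m)
      (@ones R _) i tt) Pbar_pow_ones /rvec_mul.
    under eq_csum => l do rewrite mulr1.
    by rewrite pibar_csum// subrr.
  have c0 : (fun _ : nat => 0 : R) @ \oo --> (0 : R) by exact: cvg_cst.
  by rewrite T => cv; apply: cvg_unique cv c0.
Qed.

End Deviation.

(** * The power series of the invariant measure *)

Section Series.
Variables (R : realType) (q : rates R).
Hypotheses (hpos : positive_rates q) (hstable : stable q)
  (hscale : time_scaled q).
Variable Phi : imx R (nat * nat)%type (nat * nat)%type.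

Local Notation w := (wq q).
(** The weight of a state is the weight of its queue lengths. *)
Definition ws (s : nat * nat * 'I_2) : R := w s.1.

Let w0 : forall n, 0 < w n := wq_gt0 hpos hstable.
Let ws0 : forall s, 0 < ws s := fun s => w0 s.1.
Let u0 (u : unit) : 0 < 1 :> R := ltr01.

Lemma Wmx_bounded : bounded_mx ws w (@Wmx R).
Proof.
exists 1; split=> // s; rewrite Wmx_row; apply: (wle_le (sparse_wle _ w0)).
by rewrite big_seq1 normr1.
Qed.

Lemma Vmx_bounded : bounded_mx w ws (Vmx q).
Proof.
exists 1; split=> // n; rewrite Vmx_row; apply: (wle_le (sparse_wle _ ws0)).
rewrite !big_cons big_nil addr0 /ws /= !ger0_norm ?(ltW (share_gt0 hpos _))//.
by rewrite -mulrDl share_sum.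
Qed.

Lemma G0_bounded : bounded_mx ws ws (G0 q).
Proof.
exists (2 * (cc q q1 + cc q q2)).
have c1 := cc_gt0 hpos q1; have c2 := cc_gt0 hpos q2.
split=> [|[n k]]; first by rewrite mulr_ge0// addr_ge0// ltW.
rewrite G0_row; apply: (wle_le (sparse_wle _ ws0)).
rewrite !big_cons big_nil addr0 /ws /= normrN !ger0_norm ?(ltW (cc_gt0 hpos _))//.
rewrite -mulrDl ler_wpM2r ?(ltW (w0 _))//.
by case: (queueP k) => ->; lra.
Qed.

Lemma G1_bounded : bounded_mx ws ws (G1 q).
Proof.
have l0 i := ltW (lam_gt0 hpos i); have a0 i := ltW (mu_gt0 hpos i).
have g0 i := ltW (growth_gt0 hpos hstable i).
have m0 i := mulr_ge0 (l0 i) (g0 i).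
exists (lam q q1 * growth q q1 + lam q q2 * growth q q2 + mu q q1 + mu q q2 +
  (lam q q1 + lam q q2 + mu q q1 + mu q q2)).
split; first by rewrite !addr_ge0 ?m0 ?l0 ?a0.
move=> [n k]; rewrite G1_row; apply: (wle_le (sparse_wle _ ws0)).
rewrite !big_cons big_nil /= normrN /ws /=.
have /andP[b0 b1] := busy_01 R n k.
have s1 : 0 <= mu q k * busy R n k by exact: mulr_ge0.
have s2 : mu q k * busy R n k <= mu q q1 + mu q q2.
  apply: (@le_trans _ _ (mu q k)); first by rewrite -[leRHS]mulr1 ler_wpM2l.
  by have := a0 q1; have := a0 q2; case: (queueP k) => ->; lra.
rewrite !ger0_norm ?addr_ge0// wq_up1 wq_up2.
have := ler_pM s1 (ltW (w0 _)) s2 (wq_served hpos hstable n k).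
have := ler_wpM2r (ltW (w0 n)) s2.
lra.
Qed.

Lemma Hmx_bounded : bounded_mx ws ws (Hmx q).
Proof. exact: bounded_scale ws0 G0_bounded. Qed.

Hypothesis Phi_bounded : bounded_mx w w Phi.

Let bG0 := G0_bounded.
Let bG1 := G1_bounded.
Let bV := Vmx_bounded.
Let bW := Wmx_bounded.
Let bH := Hmx_bounded.
Let GW := imx_mul (G1 q) (@Wmx R).
Let GH := imx_mul (G1 q) (Hmx q).
Let X := imx_mul (imx_mul GW Phi) (Vmx q).
Let M := imx_add (@imx_id R _) X.
Let bGW : bounded_mx ws w GW := bounded_mul ws0 w0 bG1 bW.
Let bGH : bounded_mx ws ws GH := bounded_mul ws0 ws0 bG1 bH.
Let bGWP : bounded_mx ws w (imx_mul GW Phi) := bounded_mul w0 w0 bGW Phi_bounded.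
Let bX : bounded_mx ws ws X := bounded_mul w0 ws0 bGWP bV.
Let bM : bounded_mx ws ws M := bounded_add ws0 (bounded_id ws0) bX.

Lemma Umx_bounded : bounded_mx ws ws (Umx q Phi).
Proof. exact: bounded_mul ws0 ws0 bGH bM. Qed.

(** The rows of [V] are the invariant measures of the unperturbed chain. *)
Lemma V_G0 : imx_mul (Vmx q) (G0 q) = fun _ _ => 0.
Proof.
apply/funext => n; apply/funext => t.
rewrite (imx_mul_row _ _ (Vmx_row q n)) !big_cons big_nil /= !G0E rev_q1 rev_q2.
by rewrite /share rev_q1 rev_q2; ring.
Qed.

(** [W V] is the ergodic projection of the unperturbed chain. *)
Lemma W_V : imx_mul (@Wmx R) (Vmx q) =
  imx_add (@imx_id R _) (imx_scale (csm q)^-1 (G0 q)).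
Proof.
have c0 := lt0r_neq0 (csm_gt0 hpos).
apply/funext => -[n k]; apply/funext => -[m l].
rewrite (imx_mul_row _ _ (Wmx_row R (n, k))) big_seq1 mul1r /imx_add /imx_scale G0E.
rewrite /imx_id /Vmx /= !xpair_eqE [m == n]eq_sym.
case: (n == m) => /=; last by ring.
rewrite /share -(cc_rev q k) in c0 *.
case: (queueP k) c0 => ->; case: (queueP l) => ->; rewrite ?rev_q1 ?rev_q2 /= => c0;
  by field.
Qed.

Lemma V_GW : imx_mul (Vmx q) GW = Gam q.
Proof. by rewrite /GW -(imx_mulA ws0 ws0 w0 bV bG1 bW). Qed.

Lemma H_G0 : imx_mul (Hmx q) (G0 q) = imx_scale (csm q)^-1 (G0 q).
Proof.
rewrite (imx_mulZl _ ws0 ws0 bG0 bG0) G0_G0.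
apply/funext => s; apply/funext => t; rewrite /imx_scale mulrA; congr (_ * _).
by field; rewrite lt0r_neq0// csm_gt0.
Qed.

(** [U G0 = G1 (W V - I)], because [V G0 = 0] and [H G0 = W V - I]. *)
Lemma U_G0 : imx_add (G1 q) (imx_mul (Umx q Phi) (G0 q)) = imx_mul GW (Vmx q).
Proof.
rewrite [Umx _ _]/(imx_mul GH M) (imx_mulA ws0 ws0 ws0 bGH bM bG0).
have -> : imx_mul M (G0 q) = G0 q.
  rewrite (imx_mulDl ws0 ws0 (bounded_id ws0) bX bG0) imx_mul1l.
  rewrite (imx_mulA w0 ws0 ws0 bGWP bV bG0) V_G0 imx_mul0.
  by apply/funext => s; apply/funext => t; rewrite /imx_add addr0.
rewrite (imx_mulA ws0 ws0 ws0 bG1 bH bG0) H_G0.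
rewrite (imx_mulA ws0 w0 ws0 bG1 bW bV) W_V.
rewrite (imx_mulDr ws0 ws0 bG1 (bounded_id ws0) (bounded_scale _ ws0 bG0)).
by rewrite imx_mul1.
Qed.

(** The matrix [G1] annihilates the functions that are constant. *)
Lemma G1_const J (B : imx R (nat * nat * 'I_2)%type J) (f : J -> R) :
  (forall s, B s = f) -> imx_mul (G1 q) B = fun _ _ => 0.
Proof.
move=> Bf; apply/funext => -[n k]; apply/funext => j.
rewrite (imx_mul_row _ _ (G1_row q n k)) !big_cons big_nil /= !Bf; ring.
Qed.

Hypothesis Phi_Gam :
  imx_mul Phi (Gam q) = imx_add (gam q) (imx_scale (-1) (@imx_id R _)).
Hypothesis Phi_ones : imx_mul Phi (@ones R _) = fun _ _ => 0.

Lemma gam_bounded : bounded_mx w w (gam q).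
Proof.
exists (pibar_norm q); split; first exact: wle_ge0 (pibar_wle hpos hstable).
move=> n; apply: wle_le (pibar_wle hpos hstable) _.
by rewrite -[leLHS]mulr1 ler_wpM2l ?wq_ge1//; exact: wle_ge0 (pibar_wle hpos hstable).
Qed.

(** Here [Phi] plays its part: [I + Phi Gam] is the projection [gam], whose rows
    are all equal, and [G1] annihilates constants. *)
Lemma U_GW : imx_mul (Umx q Phi) GW = fun _ _ => 0.
Proof.
rewrite [Umx _ _]/(imx_mul GH M) (imx_mulA ws0 ws0 w0 bGH bM bGW).
have -> : imx_mul M GW = imx_mul GW (gam q).
  rewrite (imx_mulDl ws0 w0 (bounded_id ws0) bX bGW) imx_mul1l.
  rewrite (imx_mulA w0 ws0 w0 bGWP bV bGW) V_GW.
  rewrite (imx_mulA w0 w0 w0 bGW Phi_bounded (Gam_bounded hpos hstable)) Phi_Gam.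
  have bi : bounded_mx w w (@imx_id R (nat * nat)%type) by exact: bounded_id.
  rewrite (imx_mulDr w0 w0 bGW gam_bounded (bounded_scale _ w0 bi)).
  rewrite (imx_mulZr _ w0 w0 bGW bi) imx_mul1.
  by apply/funext => s; apply/funext => t; rewrite /imx_add /imx_scale; ring.
rewrite (imx_mulA ws0 w0 w0 bG1 bW gam_bounded).
rewrite (@G1_const _ _ (pibar q)) ?imx_mul0// => s.
apply/funext => j; rewrite (imx_mul_row _ _ (Wmx_row R s)) big_seq1 mul1r.
by [].
Qed.

Lemma ws_ge1 s : 1 <= ws s.
Proof. exact: wq_ge1. Qed.

Let bOs : bounded_mx ws (fun _ : unit => 1) (@ones R _) := bounded_ones ws_ge1.

Lemma V_ones : imx_mul (Vmx q) (@ones R _) = @ones R _.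
Proof.
apply/funext => n; apply/funext => -[].
rewrite (imx_mul_row _ _ (Vmx_row q n)) !big_cons big_nil addr0 !mulr1.
by rewrite share_sum.
Qed.

(** All the coefficients of the series but the first have total mass zero. *)
Lemma U_ones : imx_mul (Umx q Phi) (@ones R _) = fun _ _ => 0.
Proof.
rewrite [Umx _ _]/(imx_mul GH M) (imx_mulA ws0 ws0 u0 bGH bM bOs).
have -> : imx_mul M (@ones R _) = @ones R _.
  rewrite (imx_mulDl ws0 u0 (bounded_id ws0) bX bOs) imx_mul1l.
  rewrite (imx_mulA w0 ws0 u0 bGWP bV bOs) V_ones.
  rewrite (imx_mulA w0 w0 u0 bGW Phi_bounded (bounded_ones (wq_ge1 hpos hstable))).
  rewrite Phi_ones imx_mul0.
  by apply/funext => s; apply/funext => t; rewrite /imx_add addr0.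
rewrite (imx_mulA ws0 ws0 u0 bG1 bH bOs).
rewrite (@G1_const _ _ (fun=> 0))// => -[n k]; apply/funext => j.
rewrite (imx_mulZl _ ws0 u0 bG0 bOs) /imx_scale G0_mul.
by rewrite subrr !mulr0.
Qed.

Local Notation p := (pi_coef q Phi).

Section WithNorm.
Variables (N KU : R).
Hypothesis N_norm : wle ws (rvec_mul (pibar q) (Vmx q)) N.
Hypothesis U_norm : opbound ws ws (Umx q Phi) KU.

Lemma pi_coef_wle m : wle ws (p m) (N * KU ^+ m).
Proof. exact (rvec_mul_wle ws0 ws0 N_norm (opbound_pow ws0 U_norm m)). Qed.

Lemma pi_coefS m : p m.+1 = rvec_mul (p m) (Umx q Phi).
Proof.
rewrite /pi_coef (imx_powSr ws0 U_norm).
by rewrite (rvec_mulA ws0 ws0 ws0 N_norm (opbound_pow ws0 U_norm m) U_norm).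
Qed.

Lemma pi_coef0 : p 0 = rvec_mul (pibar q) (Vmx q).
Proof. by apply/funext => s; exact: rvec_mul_id. Qed.

Lemma pi_coef_GW m : rvec_mul (p m) GW = fun=> 0.
Proof.
have [KG GK] := bGW; have [KV VK] := bV.
case: m => [|m].
  rewrite pi_coef0 (rvec_mulA w0 ws0 w0 (pibar_wle hpos hstable) VK GK) V_GW.
  exact: pibar_Gam.
by rewrite pi_coefS (rvec_mulA ws0 ws0 w0 (pi_coef_wle m) U_norm GK) U_GW rvec_mul0.
Qed.

Lemma pi_coef0_G0 : rvec_mul (p 0) (G0 q) = fun=> 0.
Proof.
have [KG GK] := bG0; have [KV VK] := bV.
rewrite pi_coef0 (rvec_mulA w0 ws0 ws0 (pibar_wle hpos hstable) VK GK) V_G0.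
exact: rvec_mul0.
Qed.

(** Invariance of the series, order by order in the perturbation parameter. *)
Lemma pi_coefS_G0 m s :
  rvec_mul (p m.+1) (G0 q) s = - rvec_mul (p m) (G1 q) s.
Proof.
have [KG GK] := bG0; have [K1 GK1] := bG1; have [KW WK] := bGW.
have [KV VK] := bV; have [KUG UGK] := bounded_mul ws0 ws0 Umx_bounded bG0.
rewrite pi_coefS (rvec_mulA ws0 ws0 ws0 (pi_coef_wle m) U_norm GK).
have := rvec_mulDr ws0 ws0 s (pi_coef_wle m) GK1 UGK.
rewrite U_G0 -(rvec_mulA ws0 w0 ws0 (pi_coef_wle m) WK VK) pi_coef_GW.
rewrite {1}/rvec_mul; under eq_csum => n do rewrite mul0r.
by rewrite (csum_cst0 R _).2 => /eqP; rewrite eq_sym addrC addr_eq0 => /eqP.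
Qed.

Lemma pi_coef0_ones : rvec_mul (p 0) (@ones R _) tt = 1.
Proof.
have [KV VK] := bV; have [KO OK] := bOs.
rewrite pi_coef0 (rvec_mulA w0 ws0 u0 (pibar_wle hpos hstable) VK OK) V_ones.
rewrite /rvec_mul; under eq_csum => n do rewrite mulr1.
exact: pibar_csum.
Qed.

Lemma pi_coefS_ones m : rvec_mul (p m.+1) (@ones R _) tt = 0.
Proof.
have [KO OK] := bOs.
rewrite pi_coefS (rvec_mulA ws0 ws0 u0 (pi_coef_wle m) U_norm OK) U_ones.
by rewrite rvec_mul0.
Qed.

Variables (e k C : R) (S : nat * nat * 'I_2 -> R).
Hypotheses (k01 : 0 <= k < 1) (ek : `|e| * KU = k).
Hypothesis pi_sum : wseries ws (fun m s => e ^+ m * p m s) S C k.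

Lemma term_wle m : wle ws (fun s => e ^+ m * p m s) (N * k ^+ m).
Proof.
apply: wle_le (wleZ ws0 (e ^+ m) (pi_coef_wle m)) _.
by rewrite -ek exprMn normrX mulrCA.
Qed.

Lemma sum_cvg s : series (fun m => e ^+ m * p m s) @ \oo --> S s.
Proof.
have := rvec_mul_series ws0 ws0 s k01 term_wle pi_sum (opbound_id ws0).
rewrite rvec_mul_id; apply: cvg_trans; apply: near_eq_cvg; apply: nearW => n.
by apply: eq_bigr => m _; rewrite rvec_mul_id.
Qed.

Lemma sum_ones : csum S = 1.
Proof.
have [KO OK] := bOs.
have := rvec_mul_series ws0 u0 tt k01 term_wle pi_sum OK.
rewrite (_ : rvec_mul S _ tt = csum S); last first.
  by apply: eq_csum => s; rewrite mulr1.
have c1 : series (fun m => rvec_mul (fun s => e ^+ m * p m s) (@ones R _) tt)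
    @ \oo --> (1 : R).
  rewrite -(cvg_shiftS _ (nbhs (1 : R))).
  apply: cvg_near_cst; apply: nearW => n.
  rewrite /series /= big_nat_recl// (rvec_mulZl ws0 u0 _ tt (pi_coef_wle 0) OK).
  rewrite expr0 mul1r pi_coef0_ones big1 ?addr0// => m _.
  by rewrite (rvec_mulZl ws0 u0 _ tt (pi_coef_wle m.+1) OK) pi_coefS_ones mulr0.
by move=> cv; apply: cvg_unique cv c1.
Qed.

(** The measure [\sum_(m < n) e^m p_m] is mapped by the perturbed transition
    matrix to itself minus [e^n p_n G0], a telescoping effect of the recurrence
    [pi_coefS_G0]; the last term is geometrically small. *)
Lemma sum_invariant s : rvec_mul S (Peps q e) s = S s.
Proof.
have [KG GK] := bG0; have [K1 GK1] := bG1.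
have bG : bounded_mx ws ws (imx_add (G0 q) (imx_scale e (G1 q))).
  exact: bounded_add ws0 bG0 (bounded_scale e ws0 bG1).
have [KE EK] : bounded_mx ws ws (Peps q e).
  exact: bounded_add ws0 (bounded_id ws0) bG.
have cv := rvec_mul_series ws0 ws0 s k01 term_wle pi_sum EK.
have E m : rvec_mul (fun s => e ^+ m * p m s) (Peps q e) s =
    e ^+ m * p m s + (e ^+ m * rvec_mul (p m) (G0 q) s -
                      e ^+ m.+1 * rvec_mul (p m.+1) (G0 q) s).
  have [KG' GK'] := bG; have pm := pi_coef_wle m.
  have e1K := opboundZ ws0 e GK1.
  rewrite (rvec_mulZl ws0 ws0 _ s pm EK).
  rewrite (rvec_mulDr ws0 ws0 s pm (opbound_id ws0) GK') rvec_mul_id.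
  rewrite (rvec_mulDr ws0 ws0 s pm GK e1K) (rvec_mulZr ws0 ws0 e s pm GK1).
  rewrite pi_coefS_G0 exprS; ring.
have T n : series (fun m => rvec_mul (fun s => e ^+ m * p m s) (Peps q e) s) n =
    series (fun m => e ^+ m * p m s) n - e ^+ n * rvec_mul (p n) (G0 q) s.
  rewrite /series /=; under eq_bigr => m _ do rewrite E.
  rewrite big_split /=; congr (_ + _).
  rewrite -[RHS]opprK opprK -[LHS]opprK; congr (- _).
  rewrite -sumrN (eq_bigr (fun m => e ^+ m.+1 * rvec_mul (p m.+1) (G0 q) s -
    e ^+ m * rvec_mul (p m) (G0 q) s)); last by move=> m _; rewrite opprB.
  by rewrite telescope_sumr// pi_coef0_G0 mulr0 subr0.
have z : (fun n => e ^+ n * rvec_mul (p n) (G0 q) s) @ \oo --> (0 : R).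
  apply/norm_cvg0P.
  apply: (@squeeze_cvgr _ _ _ _ (fun=> 0) (fun n => N * (KG / ws s) * k ^+ n)).
  - apply: nearW => n; rewrite normr_ge0 /=.
    rewrite -(rvec_mulZl ws0 ws0 _ s (pi_coef_wle n) GK).
    by have := rvec_mul_pt ws0 ws0 s (term_wle n) GK; rewrite mulrAC.
  - exact: cvg_cst.
  - exact: geo_cvg0.
have cvS : series (fun m => rvec_mul (fun s => e ^+ m * p m s) (Peps q e) s)
    @ \oo --> S s.
  rewrite (funext T) -[S s]subr0; exact: cvgB (@sum_cvg s) z.
by apply: cvg_unique cv cvS.
Qed.

End WithNorm.

End Series.

(** * The main result *)

Theorem theorem7p1 (R : realType) (q : rates R)
    (hpos : positive_rates q) (hstable : stable q) (hscale : time_scaled q)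
    (h1 : denumerable_ergodic_classes (P0 q))
    (alpha : 'I_2) (delta b : R) (u : 'cV[R]_2)
    (h2 : class_lyapunov q alpha delta b u)
    (h3irr : irreducible_chain (Pbar q))
    (alphab : queues) (deltab bb : R) (ub : queues -> R)
    (h3 : lyapunov (Pbar q) alphab deltab bb ub)
    (g : R) (hg : 0 < g)
    (h4 : (unorm (utilde ub u) (G1 q) <= g%:E)%E) :
  (exists Q : imx R state state,
     is_ergodic_projection (P0 q) Q /\ is_deviation_matrix (P0 q) Q (Hmx q)) /\
  exists gam Phi : imx R queues queues,
    [/\ is_ergodic_projection (Pbar q) gam,
        is_deviation_matrix (Pbar q) gam Phi,
        forall m, imx_mul_defined (Umx q Phi) (imx_pow (Umx q Phi) m),
        forall m, rvec_mul_defined (rvec_mul (pibar q) (Vmx q))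
                                  (imx_pow (Umx q Phi) m) &
        exists (e0 : R) (pi : R -> state -> R),
          [/\ 0 < e0,
              forall e : R, 0 < e < e0 ->
                invariant_prob (Peps q e) (pi e) /\
                (forall p : state -> R, invariant_prob (Peps q e) p ->
                   forall s, p s = pi e s) &
              l1_power_series (pi_coef q Phi) pi e0]].
Proof.
split.
  exists (imx_add (@imx_id R _) (imx_scale (csm q)^-1 (G0 q))).
  have dev := P0_deviation hpos hscale.
  by split; [exact: deviation_ergodic dev|exact: dev].
have [Phi [dev bPhi PhiGam Phi1]] := aggregated_deviation hpos hstable hscale.
have w0 := wq_gt0 hpos hstable.
have ws1 := ws_ge1 hpos hstable.
have ws0 s : 0 < ws q s by exact: lt_le_trans (ws1 s).
have [K UK] := Umx_bounded hpos hstable bPhi; have [K0 _] := UK.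
have [KV VK] := Vmx_bounded hpos hstable.
have vN := rvec_mul_wle w0 ws0 (pibar_wle hpos hstable) VK.
set N := (X in wle _ _ X) in vN.
have UmK m := opbound_pow ws0 UK m.
exists (gam q), Phi; split => //.
- exact: deviation_ergodic dev.
- by move=> m i j; exact: (rvec_mul_asummable ws0 ws0 j (UK.2 i) (UmK m)).
- by move=> m j; exact: (rvec_mul_asummable ws0 ws0 j vN (UmK m)).
have K1 : 0 < K + 1 by rewrite ltr_wpDl.
(* On this disc the ratio [`|e| * K] of the geometric bounds is below [1/2]. *)
pose e0 : R := (2 * (K + 1))^-1.
have e00 : 0 < e0 by rewrite invr_gt0 mulr_gt0.
have kP (e : R) : `|e| < e0 -> 0 <= `|e| * K < 1.
  move=> ee0; rewrite mulr_ge0//=; apply: (@le_lt_trans _ _ (e0 * (K + 1))).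
    by apply: ler_pM => //; [exact: ltW|rewrite lerDl].
  have -> : e0 * (K + 1) = 2^-1 by rewrite /e0; field; exact: lt0r_neq0.
  by rewrite invf_lt1// ltr1n.
have /choice[pi piP] (e : R) : exists S, `|e| < e0 ->
    wseries (ws q) (fun m s => e ^+ m * pi_coef q Phi m s) S
      (N * (1 - `|e| * K)^-1) (`|e| * K).
  have [ee0|] := boolP (`|e| < e0); last by exists (fun=> 0).
  have [|S HS] := wseries_exists ws0 (kP _ ee0)
    (v := fun m s => e ^+ m * pi_coef q Phi m s) (C := N).
    by move=> m; exact: (term_wle hpos hstable vN UK erefl).
  by exists S.
exists e0, pi; split => //; last first.
  by move=> e ee0; exact: wseries_l1 ws1 (kP _ ee0) (piP _ ee0).
move=> e /andP[egt0 ee0].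
have e1 : e <= 1.
  apply: ltW; apply: lt_trans ee0 _.
  by rewrite /e0 invf_lt1 ?mulr_gt0//; lra.
have ae : `|e| < e0 by rewrite gtr0_norm.
apply: invariant_prob_unique => //.
- exact: wle_asummable_ge1 ws1 (wseries_wle ws0 (piP _ ae)).
- exact: (sum_ones hpos hstable bPhi Phi1 vN UK (kP _ ae) erefl (piP _ ae)).
- exact: (sum_invariant hpos hstable bPhi PhiGam vN UK (kP _ ae) erefl (piP _ ae)).
Qed.
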